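(* Let $\mathcal X$ be a multihomogeneous variety of representations of Lie algebras over a field $K$. Let $L$ be an absolutely free Lie algebra over $K$ with a system of free generators $\{x_i, i\in I\}$, let $M$ be an ideal of $L$, and let $\mathcal F$ be the absolutely free associative algebra with unity over $K$ freely generated by $\{x_i, i\in I\}$ (so $\mathcal F=U(L)$). Let $\mathcal F_1=U(M)$ be the universal enveloping algebra of $M$, regarded as a subalgebra of $\mathcal F$. Let $L_1$ be an absolutely free Lie algebra over $K$ with a system of free generators $\{y_i, i\in I\}$, and let $\Phi$ be the absolutely free associative algebra with unity freely generated by $\{y_i,i\in I\}$, so that $(\Phi/\mathcal X^*(\Phi,L_1),L_1)$ is the free cyclic representation of the variety $\mathcal X$ freely generated by $\{y_i,i\in I\}$. For $x\in L$ let $\bar x$ denote the image of $x$ in $L/M$ under the canonical epimorphism. Then the mapping $x_i\mapsto y_i+\bar x_i$ $(i\in I)$ extends to a monomorphism of the representation $(\mathcal F/\mathcal F\mathcal X^*(\mathcal F_1,M),\,L)$ into the mixed wreath $\mathcal X$-product $(\Phi/\mathcal X^*(\Phi,L_1),L_1)\stackrel{\mathcal X}{\mathrm{wr}}L/M$.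
   Context: **Pairs.** A representation of a Lie algebra over $K$ (a Lie pair) is a pair $(V,A)$, where $A$ is a Lie algebra over $K$ and $V$ is a right $A$-module, equivalently a right $U(A)$-module ($U(A)$ is the universal enveloping algebra). A homomorphism $(V,A)\to(V',A')$ is a pair consisting of a linear map $V\to V'$ and a Lie algebra homomorphism $A\to A'$ compatible with the actions; it is a monomorphism if both components are injective. A subpair (subrepresentation) consists of a Lie subalgebra and a subspace invariant under it. **Varieties.** An (action) identity is an expression $y\,v(x_1,\dots,x_n)=0$, with $v$ in the free associative algebra with unity on $x_1,x_2,\dots$; it holds in $(V,A)$ if $w\,v(a_1,\dots,a_n)=0$ for all $w\in V$, $a_j\in A$. A variety of representations is the class of all pairs over $K$ satisfying some set of such identities. It is multihomogeneous if, whenever $yv=0$ is an identity of the variety and $v=\sum_\alpha v_\alpha$ is the decomposition of $v$ into multihomogeneous components, each $yv_\alpha=0$ is also an identity of the variety. **Verbal submodule.** For a pair $(V,A)$, $\mathcal X^*(V,A)$ is the $A$-submodule of $V$ generated by all $w\,v(a_1,\dots,a_n)$ with $w\in V$, $a_j\in A$ and $yv=0$ an identity of $\mathcal X$; it is the least submodule $V_0$ with $(V/V_0,A)\in\mathcal X$. In $\mathcal X^*(\mathcal F_1,M)$ and $\mathcal X^*(\Phi,L_1)$ the Lie algebras $M\subset\mathcal F_1$ and $L_1\subset\Phi=U(L_1)$ act by right multiplication. $\mathcal F\mathcal X^*(\mathcal F_1,M)$ is the linear span of all products $fg$ with $f\in\mathcal F$, $g\in\mathcal X^*(\mathcal F_1,M)$;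 it is invariant under right multiplication by $L$, so $L$ acts on $\mathcal F/\mathcal F\mathcal X^*(\mathcal F_1,M)$ by right multiplication. **Mixed wreath $\mathcal X$-product.** Let $(V,A)\in\mathcal X$ and let $B$ be a Lie algebra over $K$. A pair $(G,\Gamma)$, with $B$ a subalgebra of $\Gamma$, is the mixed wreath $\mathcal X$-product of $(V,A)$ and $B$, denoted $(V,A)\stackrel{\mathcal X}{\mathrm{wr}}B$, if: 1. $(V,A)$ is a subpair of $(G,\Gamma)$; 2. $A$ and $B$ generate $\Gamma$; 3. $V$ generates $G$ as a $\Gamma$-module; 4. if $P$ is the ideal of $\Gamma$ generated by $A$, then $(G,P)\in\mathcal X$; 5. whenever $\varphi:(V,A)\to(G_1,\Gamma_1)$ and $\psi:B\to\Gamma_1$ are homomorphisms such that $\varphi(A)$ and $\psi(B)$ generate $\Gamma_1$, $\varphi(V)$ generates $G_1$ as a $\Gamma_1$-module, and $(G_1,Q)\in\mathcal X$ where $Q$ is the ideal of $\Gamma_1$ generated by $\varphi(A)$, there is a unique homomorphism $\chi:(G,\Gamma)\to(G_1,\Gamma_1)$ restricting to $\varphi$ on $(V,A)$ and to $\psi$ on $B$. When $\mathcal X$ is multihomogeneous, $K$ is a field and $(V,A)=(\Phi/\mathcal X^*(\Phi,L_1),L_1)$, it can be realized with $\Gamma=L_1*B=P\rtimes B$ (free product of Lie algebras, $P$ the ideal generated by $L_1$) and $G=U(\Gamma)/\mathcal X^*(U(\Gamma),P)\cong U(B)\otimes_K\big(U(P)/\mathcal X^*(U(P),P)\big)$, with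 $\Gamma$ acting by right multiplication on $U(\Gamma)$. **Convention.** A cyclic pair comes with a distinguished module generator, the image of $1$; here these are the image of $1\in\mathcal F$, and the image of $1\in\Phi$ in $\Phi/\mathcal X^*(\Phi,L_1)\subset G$. ''The mapping $x_i\mapsto y_i+\bar x_i$ extends to a homomorphism of pairs'' means that the Lie component sends $x_i$ to $y_i+\bar x_i\in\Gamma$ and the module component sends the generator (image of $1\in\mathcal F$) to the generator (image of $1\in\Phi$). *)

(* Defs.v *)
From HB Require Import structures.
From mathcomp Require Import all_boot all_order all_algebra.
From mathcomp Require Import boolp.
From mathcomp Require Import finmap monalg.

Set Implicit Arguments.
Unset Strict Implicit.
Unset Printing Implicit Defensive.

Import GRing.Theory.

Local Open Scope ring_scope.
Local Open Scope quotient_scope.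

(* {malg K[{fmonom I}]} is only declared as a left algebra in the library; the
   alias carries the full algebra structure. *)
Definition freealg (K : fieldType) (I : choiceType) := {malg K[{fmonom I}]}.

HB.instance Definition _ (K : fieldType) (I : choiceType) :=
  GRing.Lalgebra.on (freealg K I).

Fact freealg_scalerAr (K : fieldType) (I : choiceType) (k : K)
  (u v : freealg K I) : k *: (u * v) = u * (k *: v).
Proof.
apply/malgP => m; rewrite mcoeffZ (mcoeffMlw (d1 := msupp u) (d2 := msupp v)) //.
rewrite (mcoeffMlw (d1 := msupp u) (d2 := msupp v)) //; last first.
  exact: msuppZ_le.
rewrite mulr_sumr; apply: eq_bigr => m1 _; rewrite mulr_sumr.
by apply: eq_bigr => m2 _; rewrite mcoeffZ mulrnAr mulrCA.
Qed.

HB.instance Definition _ (K : fieldType) (I : choiceType) :=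
  GRing.Lalgebra_isAlgebra.Build K (freealg K I) (@freealg_scalerAr K I).

Definition freegen (K : fieldType) (I : choiceType) (i : I) : freealg K I :=
  << fmu i >>.

Record subspace (K : fieldType) (V : lmodType K) := MkSubspace {
  subspace_pred :> {pred V};
  subspace_submod : submod_closed subspace_pred
}.

HB.instance Definition _ (K : fieldType) (V : lmodType K) (S : subspace V) :=
  GRing.isSubmodClosed.Build K V (subspace_pred S)
    (GRing.submod_closed_semi (subspace_submod S)).

Section QuotientSpace.
Context (K : fieldType) (V : lmodType K) (S : subspace V).

Definition quotsp : Type := {ideal_quot S}.

HB.instance Definition _ := GRing.Zmodule.on quotsp.

Definition qpi (v : V) : quotsp := \pi_({ideal_quot S}) v.
Definition qrepr (q : quotsp) : V := repr (q : {ideal_quot S}).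

Lemma qreprK : cancel qrepr qpi.
Proof. exact: reprK. Qed.

Lemma qpiP u v : (qpi u = qpi v) <-> (u - v \in S).
Proof.
split=> [|h]; first by move=> /eqP; rewrite /qpi -Quotient.idealrBE.
by apply/eqP; rewrite /qpi -Quotient.idealrBE.
Qed.

Lemma qpiD : {morph qpi : u v / u + v}.
Proof. exact: Quotient.pi_add. Qed.

Lemma qpi0 : qpi 0 = 0.
Proof. by apply: (addrI (qpi 0)); rewrite -qpiD !addr0. Qed.

Lemma qreprP v : qrepr (qpi v) - v \in S.
Proof. by apply/qpiP; rewrite qreprK. Qed.

Definition qscale (k : K) (q : quotsp) : quotsp := qpi (k *: qrepr q).

Lemma qpiZ k v : qpi (k *: v) = qscale k (qpi v).
Proof.
apply/esym/qpiP; rewrite -scalerBr; apply: rpredZ; exact: qreprP.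
Qed.

Fact qscalerA a b q : qscale a (qscale b q) = qscale (a * b) q.
Proof. by rewrite -(qreprK q) -!qpiZ scalerA. Qed.

Fact qscale1r : left_id 1 qscale.
Proof. by move=> q; rewrite -(qreprK q) -qpiZ scale1r. Qed.

Fact qscalerDr : right_distributive qscale +%R.
Proof.
move=> a p q; rewrite -(qreprK p) -(qreprK q).
by rewrite -qpiD -!qpiZ scalerDr qpiD.
Qed.

Fact qscalerDl q : {morph qscale^~ q : a b / a + b}.
Proof. by move=> a b; rewrite -(qreprK q) -!qpiZ scalerDl qpiD. Qed.

HB.instance Definition _ := GRing.Zmodule_isLmodule.Build K quotsp
  qscalerA qscale1r qscalerDr qscalerDl.

Lemma qpi_linear : linear qpi.
Proof. by move=> k u v; rewrite qpiD qpiZ. Qed.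

End QuotientSpace.

Arguments qpi {K V} S v.

Section LinearSpan.
Context (K : fieldType) (V : lmodType K) (D : V -> Prop).

Definition lspan_pred : {pred V} :=
  fun z => `[< forall N : subspace V, (forall w, D w -> w \in N) -> z \in N >].

Fact lspan_submod : submod_closed lspan_pred.
Proof.
split=> [|k u v /asboolP hu /asboolP hv]; apply/asboolP => N hN; first exact: rpred0.
by apply: rpredD; [apply: rpredZ; exact: hu | exact: hv].
Qed.

Definition lspan : subspace V := MkSubspace lspan_submod.

End LinearSpan.

HB.mixin Record Lmodule_isLie (K : fieldType) L of GRing.Lmodule K L := {
  lie : L -> L -> L;
  lie_linearl : forall y, linear (lie^~ y);
  lie_linearr : forall x, linear (lie x);
  liexx : forall x, lie x x = 0;
  lie_jacobi : forall x y z,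
    lie x (lie y z) + lie y (lie z x) + lie z (lie x y) = 0
}.

#[short(type="lieAlgType")]
HB.structure Definition Lie (K : fieldType) :=
  {L of GRing.Lmodule K L & Lmodule_isLie K L}.

Section LieHomomorphisms.
Context (K : fieldType).

Definition lie_hom (A B : lieAlgType K) (f : A -> B) : Prop :=
  linear f /\ {morph f : x y / lie x y}.

(* Lie homomorphism into the commutator Lie algebra of U. *)
Definition lie_assoc_hom (A : lieAlgType K) (U : algType K) (f : A -> U) : Prop :=
  linear f /\ forall x y, f (lie x y) = f x * f y - f y * f x.

Definition free_lie (I : Type) (L : lieAlgType K) (x : I -> L) : Prop :=
  forall (A : lieAlgType K) (a : I -> A),
    exists f : L -> A, [/\ lie_hom f, forall i, f (x i) = a i &
      forall f', lie_hom f' -> (forall i, f' (x i) = a i) -> f' =1 f].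

Definition enveloping (A : lieAlgType K) (U : algType K) (j : A -> U) : Prop :=
  lie_assoc_hom j /\
  forall (R : algType K) (f : A -> R), lie_assoc_hom f ->
    exists g : {lrmorphism U -> R}, (forall a, g (j a) = f a) /\
      forall g' : {lrmorphism U -> R}, (forall a, g' (j a) = f a) -> g' =1 g.

End LieHomomorphisms.

Record lieSubalg (K : fieldType) (L : lieAlgType K) := MkLieSubalg {
  subalg_space :> subspace L;
  rpred_lie : {in subalg_space &, forall x y, lie x y \in subalg_space}
}.

Record lieIdeal (K : fieldType) (L : lieAlgType K) := MkLieIdeal {
  ideal_space :> subspace L;
  rpred_liel : forall x y, x \in ideal_space -> lie x y \in ideal_space
}.

Coercion ideal_subalg (K : fieldType) (L : lieAlgType K) (M : lieIdeal L) :
    lieSubalg L :=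
  @MkLieSubalg K L M (fun x y hx _ => rpred_liel y hx).

Section LieTheory.
Context (K : fieldType) (L : lieAlgType K).
Implicit Types x y z : L.

Lemma lieDl x y z : lie (x + y) z = lie x z + lie y z.
Proof. by have := lie_linearl z 1 x y; rewrite /= !scale1r. Qed.

Lemma lieDr x y z : lie x (y + z) = lie x y + lie x z.
Proof. by have := lie_linearr x 1 y z; rewrite !scale1r. Qed.

Lemma lieC x y : lie x y = - lie y x.
Proof.
apply/eqP; rewrite -addr_eq0; apply/eqP.
by have := liexx (x + y); rewrite lieDl !lieDr !liexx add0r addr0.
Qed.

Lemma lieNl x y : lie (- x) y = - lie x y.
Proof.
apply/eqP; rewrite -addr_eq0 -lieDl addNr; apply/eqP.
by have := lieDl 0 0 y; rewrite addr0 => /eqP; rewrite -subr_eq subrr eq_sym => /eqP.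
Qed.

Lemma lieNr x y : lie x (- y) = - lie x y.
Proof. by rewrite lieC lieNl -lieC. Qed.

Lemma rpred_lier (M : lieIdeal L) x y : y \in M -> lie x y \in M.
Proof. by move=> hy; rewrite lieC rpredN; apply: rpred_liel. Qed.

End LieTheory.

Section SubLie.
Context (K : fieldType) (L : lieAlgType K) (S : lieSubalg L).

Record sublie : predArgType := Sublie { sublie_val : L; _ : sublie_val \in S }.

HB.instance Definition _ := [isSub for sublie_val].
HB.instance Definition _ := [Choice of sublie by <:].
HB.instance Definition _ := [SubChoice_isSubZmodule of sublie by <:].
HB.instance Definition _ := [SubZmodule_isSubLmodule of sublie by <:].

Definition sub_lie (x y : sublie) : sublie :=
  Sub (lie (val x) (val y)) (rpred_lie (valP x) (valP y)).

Fact sub_lie_linearl y : linear (sub_lie^~ y).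
Proof. by move=> k u v; apply: val_inj; exact: lie_linearl. Qed.

Fact sub_lie_linearr x : linear (sub_lie x).
Proof. by move=> k u v; apply: val_inj; exact: lie_linearr. Qed.

Fact sub_liexx x : sub_lie x x = 0.
Proof. by apply: val_inj; exact: liexx. Qed.

Fact sub_lie_jacobi x y z :
  sub_lie x (sub_lie y z) + sub_lie y (sub_lie z x) + sub_lie z (sub_lie x y) = 0.
Proof. by apply: val_inj; exact: lie_jacobi. Qed.

HB.instance Definition _ := Lmodule_isLie.Build K sublie
  sub_lie_linearl sub_lie_linearr sub_liexx sub_lie_jacobi.

End SubLie.

Section QuotientLie.
Context (K : fieldType) (L : lieAlgType K) (M : lieIdeal L).

Definition quotlie : Type := quotsp M.

HB.instance Definition _ := GRing.Lmodule.on quotlie.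

Definition quot_lie (p q : quotlie) : quotlie := qpi M (lie (qrepr p) (qrepr q)).

Lemma qpi_lie x y : quot_lie (qpi M x) (qpi M y) = qpi M (lie x y).
Proof.
apply/qpiP.
have -> : lie (qrepr (qpi M x)) (qrepr (qpi M y)) - lie x y =
  lie (qrepr (qpi M x) - x) (qrepr (qpi M y)) + lie x (qrepr (qpi M y) - y).
  by rewrite lieDl lieDr lieNl lieNr addrA subrK.
apply: rpredD; first by apply: rpred_liel; exact: qreprP.
by apply: rpred_lier; exact: qreprP.
Qed.

Fact quot_lie_linearl q : linear (quot_lie^~ q).
Proof.
move=> k u v; rewrite -(qreprK q) -(qreprK u) -(qreprK v) /=.
by rewrite -qpi_linear !qpi_lie lie_linearl qpi_linear.
Qed.

Fact quot_lie_linearr q : linear (quot_lie q).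
Proof.
move=> k u v; rewrite -(qreprK q) -(qreprK u) -(qreprK v).
by rewrite -qpi_linear !qpi_lie lie_linearr qpi_linear.
Qed.

Fact quot_liexx q : quot_lie q q = 0.
Proof. by rewrite -(qreprK q) qpi_lie liexx qpi0. Qed.

Fact quot_lie_jacobi x y z :
  quot_lie x (quot_lie y z) + quot_lie y (quot_lie z x)
  + quot_lie z (quot_lie x y) = 0.
Proof.
rewrite -(qreprK x) -(qreprK y) -(qreprK z) !qpi_lie -!qpiD lie_jacobi.
exact: qpi0.
Qed.

HB.instance Definition _ := Lmodule_isLie.Build K quotlie
  quot_lie_linearl quot_lie_linearr quot_liexx quot_lie_jacobi.

End QuotientLie.

Section LieGeneration.
Context (K : fieldType) (L : lieAlgType K) (D : L -> Prop).

Definition lie_generates : Prop :=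
  forall S : lieSubalg L, (forall x, D x -> x \in S) -> forall z, z \in S.

Definition ideal_gen_pred : {pred L} :=
  fun z => `[< forall J : lieIdeal L, (forall x, D x -> x \in J) -> z \in J >].

Fact ideal_gen_submod : submod_closed ideal_gen_pred.
Proof.
split=> [|k u v /asboolP hu /asboolP hv]; apply/asboolP => J hJ; first exact: rpred0.
by apply: rpredD; [apply: rpredZ; exact: hu | exact: hv].
Qed.

Fact ideal_gen_lie x y : x \in MkSubspace ideal_gen_submod ->
  lie x y \in MkSubspace ideal_gen_submod.
Proof. by move=> /asboolP hx; apply/asboolP => J hJ; apply/rpred_liel/hx. Qed.

Definition ideal_gen : lieIdeal L := MkLieIdeal ideal_gen_lie.

End LieGeneration.

(* A pair (V, A): the Lie algebra A acts on V on the right. *)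
Record lie_pair (K : fieldType) := MkLiePair {
  pmod : lmodType K;
  plie : lieAlgType K;
  pact : pmod -> plie -> pmod;
  pact_linearl : forall a, linear (pact^~ a);
  pact_linearr : forall w, linear (pact w);
  pact_lie : forall w a b,
    pact w (lie a b) = pact (pact w a) b - pact (pact w b) a
}.

Section Pairs.
Context (K : fieldType).
Implicit Types W : lie_pair K.

Definition pair_hom W W' (f : pmod W -> pmod W') (g : plie W -> plie W') : Prop :=
  [/\ linear f, lie_hom g & forall w a, f (pact w a) = pact (f w) (g a)].

Definition pair_mono W W' (f : pmod W -> pmod W') (g : plie W -> plie W') : Prop :=
  [/\ pair_hom f g, injective f & injective g].

Definition act_closed W (N : subspace (pmod W)) : Prop :=
  forall w a, w \in N -> pact w a \in N.

Definition module_generates W (D : pmod W -> Prop) : Prop :=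
  forall N : subspace (pmod W), act_closed N ->
    (forall w, D w -> w \in N) -> forall z, z \in N.

Section SubPair.
Context (W : lie_pair K) (S : lieSubalg (plie W)).

Definition sub_pact (w : pmod W) (a : sublie S) : pmod W := pact w (val a).

Fact sub_pact_linearl a : linear (sub_pact^~ a).
Proof. exact: pact_linearl. Qed.

Fact sub_pact_linearr w : linear (sub_pact w).
Proof. by move=> k a b; exact: pact_linearr. Qed.

Fact sub_pact_lie w a b :
  sub_pact w (lie a b) = sub_pact (sub_pact w a) b - sub_pact (sub_pact w b) a.
Proof. exact: pact_lie. Qed.

Definition sub_pair : lie_pair K :=
  MkLiePair sub_pact_linearl sub_pact_linearr sub_pact_lie.

End SubPair.

Section QuotientPair.
Context (W : lie_pair K) (N : subspace (pmod W)) (hN : act_closed N).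

Definition quot_pact (q : quotsp N) (a : plie W) : quotsp N :=
  qpi N (pact (qrepr q) a).

Lemma qpi_pact w a : quot_pact (qpi N w) a = qpi N (pact w a).
Proof.
apply/qpiP.
have -> : pact (qrepr (qpi N w)) a - pact w a = pact (qrepr (qpi N w) - w) a.
  have h := pact_linearl a (-1) w (qrepr (qpi N w)).
  by rewrite !scaleN1r /= in h; rewrite [in RHS]addrC h addrC.
by apply: hN; exact: qreprP.
Qed.

Fact quot_pact_linearl a : linear (quot_pact^~ a).
Proof.
move=> k p q; rewrite -(qreprK p) -(qreprK q) -qpi_linear !qpi_pact.
by rewrite pact_linearl qpi_linear.
Qed.

Fact quot_pact_linearr q : linear (quot_pact q).
Proof. by move=> k a b; rewrite -(qreprK q) !qpi_pact pact_linearr qpi_linear. Qed.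

Fact quot_pact_lie q a b :
  quot_pact q (lie a b) = quot_pact (quot_pact q a) b - quot_pact (quot_pact q b) a.
Proof.
rewrite -(qreprK q) !qpi_pact pact_lie addrC -scaleN1r qpi_linear scaleN1r.
by rewrite addrC.
Qed.

Definition quot_pair : lie_pair K :=
  MkLiePair quot_pact_linearl quot_pact_linearr quot_pact_lie.

End QuotientPair.

Section RegularPair.
Context (A : lieAlgType K) (U : algType K) (j : A -> U) (hj : lie_assoc_hom j).

Definition reg_pact (u : U) (a : A) : U := u * j a.

Fact reg_pact_linearl a : linear (reg_pact^~ a).
Proof. by move=> k u v; rewrite /reg_pact mulrDl scalerAl. Qed.

Fact reg_pact_linearr u : linear (reg_pact u).
Proof. by move=> k a b; rewrite /reg_pact hj.1 mulrDr scalerAr. Qed.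

Fact reg_pact_lie u a b :
  reg_pact u (lie a b) = reg_pact (reg_pact u a) b - reg_pact (reg_pact u b) a.
Proof. by rewrite /reg_pact hj.2 mulrBr !mulrA. Qed.

Definition reg_pair : lie_pair K :=
  MkLiePair reg_pact_linearl reg_pact_linearr reg_pact_lie.

End RegularPair.

Section GeneratedSubmodule.
Context (W : lie_pair K) (D : pmod W -> Prop).

Definition submod_gen_pred : {pred pmod W} :=
  fun z => `[< forall N : subspace (pmod W), act_closed N ->
                 (forall w, D w -> w \in N) -> z \in N >].

Fact submod_gen_submod : submod_closed submod_gen_pred.
Proof.
split=> [|k u v /asboolP hu /asboolP hv]; apply/asboolP => N aN hN.
  exact: rpred0.
by apply: rpredD; [apply: rpredZ; exact: hu | exact: hv].
Qed.

Definition submod_gen : subspace (pmod W) := MkSubspace submod_gen_submod.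

Lemma submod_gen_act : act_closed submod_gen.
Proof.
by move=> w a /asboolP hw; apply/asboolP => N aN hN; apply/aN/hw.
Qed.

End GeneratedSubmodule.

(* The identity y v(x_0, x_1, ...) = 0 is coded by v; pair_eval v w a is
   w v(a_0, a_1, ...), a word x_i x_j ... acting by a_i first. *)
Definition pair_eval W (v : freealg K nat) (w : pmod W) (a : nat -> plie W) :
    pmod W :=
  \sum_(m <- msupp v) v@_m *: foldl (fun u i => pact u (a i)) w (m : seq nat).

Definition satisfies W (v : freealg K nat) : Prop :=
  forall w a, pair_eval v w a = 0 :> pmod W.

Implicit Types X : lie_pair K -> Prop.

Definition variety X : Prop :=
  exists E : freealg K nat -> Prop,
    forall W, X W <-> (forall v, E v -> satisfies W v).

Definition identity_of X (v : freealg K nat) : Prop :=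
  forall W, X W -> satisfies W v.

Definition multideg (m : {fmonom nat}) : {cmonom nat} :=
  \big[mmul/mone]_(i <- (m : seq nat)) ucm i.

Definition mhcomp (alpha : {cmonom nat}) (v : freealg K nat) : freealg K nat :=
  \sum_(m <- msupp v | multideg m == alpha) << v@_m *g m >>.

Definition multihomogeneous X : Prop :=
  forall v, identity_of X v -> forall alpha, identity_of X (mhcomp alpha v).

Definition verbal X W : subspace (pmod W) :=
  submod_gen (fun z => exists v w a, identity_of X v /\ z = pair_eval v w a).

Lemma verbal_act X W : act_closed (verbal X W).
Proof. exact: submod_gen_act. Qed.

Definition verbal_quot X W : lie_pair K := quot_pair (@verbal_act X W).

(* W is the mixed wreath X-product of the pair VA and the Lie algebra B, which
   are embedded in W by (iV, iA) and iB. *)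
Record mixed_wreath X (VA : lie_pair K) (B : lieAlgType K) (W : lie_pair K)
    (iV : pmod VA -> pmod W) (iA : plie VA -> plie W) (iB : B -> plie W) : Prop :=
  MkMixedWreath {
  wreath_in : X VA;
  wreath_lie_mono : lie_hom iB /\ injective iB;
  wreath_pair_mono : pair_mono iV iA;
  wreath_lie_gen :
    lie_generates (fun z => (exists a, z = iA a) \/ (exists b, z = iB b));
  wreath_mod_gen : module_generates (fun z => exists w, z = iV w);
  wreath_ideal : X (sub_pair (ideal_gen (fun z => exists a, z = iA a)));
  wreath_univ : forall (W1 : lie_pair K) (fV : pmod VA -> pmod W1)
    (fA : plie VA -> plie W1) (psi : B -> plie W1),
    pair_hom fV fA -> lie_hom psi ->
    lie_generates (fun z => (exists a, z = fA a) \/ (exists b, z = psi b)) ->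
    module_generates (fun z => exists w, z = fV w) ->
    X (sub_pair (ideal_gen (fun z => exists a, z = fA a))) ->
    exists (cV : pmod W -> pmod W1) (cA : plie W -> plie W1),
      [/\ pair_hom cV cA,
          [/\ forall w, cV (iV w) = fV w, forall a, cA (iA a) = fA a &
              forall b, cA (iB b) = psi b] &
          forall cV' cA', pair_hom cV' cA' ->
            [/\ forall w, cV' (iV w) = fV w, forall a, cA' (iA a) = fA a &
                forall b, cA' (iB b) = psi b] ->
            cV' =1 cV /\ cA' =1 cA]
}.

End Pairs.

Arguments mixed_wreath {K} X VA B W iV iA iB.

(* F X^*(F1, M), with F1 mapped into F by e. *)
Definition mul_verbal (K : fieldType) (X : lie_pair K -> Prop) (M : lieAlgType K)
    (F1 F : algType K) (j : M -> F1) (hj : lie_assoc_hom j) (e : F1 -> F) :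
    subspace F :=
  lspan (fun z => exists f g, g \in verbal X (reg_pair hj) /\ z = f * e g).

(* Main.v *)
(** Let B = L/M and Q = F1/X^*(F1,M). Take a totally ordered basis of B with
    lifts xi_k in L, let S be the span of the sorted words in the basis, on which
    B acts as on U(B) (Poincare-Birkhoff-Witt), by coderivations of the unshuffle
    coproduct, and let s(k1 ... kn) = xi_k1 ... xi_kn in F. Then, over any field,
      l s(N) = s(l N) + sum s(N') a_l(N'')     (l in L, N a sorted word)
    for certain functions a_l from S to M, where the sum runs over the splittings
    of N into complementary subwords.

    Consequently F = sum s(N) F1, and the functions h from S to Q carry a right
    action of F such that h applied to u = sum s(N) q_N takes the value
    sum h(N) q_N at the empty word: x_i acts as the coderivation of its image in
    B plus the convolution with a_{x_i}. Since X is multihomogeneous, convolution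
    operators with values in M satisfy the identities of X (induct on the words
    at which functions are evaluated, with linearized identities). By the
    universal property, the wreath product maps to this pair with its generator
    going to any prescribed h. So if u kills the generator, then all q_N, suitably
    collected, lie in X^*(F1,M), that is, u is in F X^*(F1,M).

    Conversely F X^*(F1,M) kills the generator because M is mapped into the ideal
    generated by L1. In particular F X^*(F1,M) is a kernel, hence a submodule. *)

Require Import Defs.
From HB Require Import structures.
From mathcomp Require Import all_boot all_order all_algebra.
From mathcomp Require Import boolp.
From mathcomp Require Import finmap monalg.
From mathcomp Require Import functions wochoice.

Set Implicit Arguments.
Unset Strict Implicit.
Unset Printing Implicit Defensive.

Import GRing.Theory.

Local Open Scope ring_scope.

(** * Equations in abelian groups, by reflection *)

Inductive zexp := ZVar of nat | ZZero | ZAdd of zexp & zexp | ZOpp of zexp.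

Section ZmodReflection.
Context (V : zmodType).

Fixpoint zeval (r : seq V) e : V :=
  match e with
  | ZVar n => nth 0 r n
  | ZZero => 0
  | ZAdd e f => zeval r e + zeval r f
  | ZOpp e => - zeval r e
  end.

(** The boolean carries the sign of an atom, [true] for minus. *)
Fixpoint zlin e (b : bool) : seq (bool * nat) :=
  match e with
  | ZVar n => [:: (b, n)]
  | ZZero => [::]
  | ZAdd e f => zlin e b ++ zlin f b
  | ZOpp e => zlin e (~~ b)
  end.

Fixpoint zins b n (l : seq (bool * nat)) :=
  if l is (c, m) :: l' then
    if (n == m) && (b != c) then l' else (c, m) :: zins b n l'
  else [:: (b, n)].

Definition zred l := foldr (fun p => zins p.1 p.2) [::] l.

Let val (r : seq V) (p : bool * nat) :
  V := if p.1 then - nth 0 r p.2 else nth 0 r p.2.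

Let zlinP r e b : \sum_(p <- zlin e b) val r p =
  if b then - zeval r e else zeval r e.
Proof.
elim: e b => [n|| e IHe f IHf|e IHe] b /=.
- by rewrite big_seq1.
- by rewrite big_nil; case: b; rewrite ?oppr0.
- by rewrite big_cat IHe IHf; case: b; rewrite ?opprD.
- by rewrite IHe; case: b; rewrite ?opprK.
Qed.

Let zinsP r b n l : \sum_(p <- zins b n l) val r p =
  val r (b, n) + \sum_(p <- l) val r p.
Proof.
elim: l => [|[c m] l IH] /=; first by rewrite big_seq1 big_nil addr0.
case: ifP => [/andP[/eqP <- bc]|_]; last by rewrite !big_cons IH addrCA.
by rewrite big_cons addrA; clear IH; case: b c bc => [] [] //= _;
  rewrite /val /= ?addNr ?subrr add0r.
Qed.

(** Cancelling opposite atoms preserves the value, so a difference that cancels to the empty list is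
    0. The premise is settled by computation. *)
Lemma zeqP r e f : zred (zlin (ZAdd e (ZOpp f)) false) = [::] ->
  zeval r e = zeval r f.
Proof.
move=> h; apply/eqP; rewrite -subr_eq0; apply/eqP.
rewrite -[LHS]/(zeval r (ZAdd e (ZOpp f))) -[LHS](zlinP _ _ false).
suff <- : \sum_(p <- zred (zlin (ZAdd e (ZOpp f)) false)) val r p =
    \sum_(p <- zlin (ZAdd e (ZOpp f)) false) val r p by rewrite h big_nil.
by elim: zlin => [|[c m] l IH] //=; rewrite zinsP big_cons IH.
Qed.

End ZmodReflection.

(* Occurrences of an atom may differ by convertible paths to its structure. *)
Ltac zsame x y := first [constr_eq x y | unify x y].

Ltac zlookup x r :=
  match r with
  | ?y :: _ => let _ := match goal with _ => zsame x y end in constr:(O)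
  | _ :: ?r' => let n := zlookup x r' in constr:(S n)
  end.

Ltac zatoms t r :=
  match t with
  | (?a + ?b)%R => let r := zatoms a r in zatoms b r
  | (- ?a)%R => zatoms a r
  | 0%R => r
  | _ => match r with
         | _ => let _ := zlookup t r in r
         | _ => constr:(t :: r)
         end
  end.

Ltac zquote t r :=
  match t with
  | (?a + ?b)%R => let e := zquote a r in let f := zquote b r in constr:(ZAdd e f)
  | (- ?a)%R => let e := zquote a r in constr:(ZOpp e)
  | 0%R => constr:(ZZero)
  | _ => let n := zlookup t r in constr:(ZVar n)
  end.

Ltac zmod :=
  match goal with
  | |- @eq ?V ?a ?b =>
      let r := zatoms a (@nil V) in let r := zatoms b r in
      let e := zquote a r in let f := zquote b r in
      exact: (@zeqP _ r e f erefl)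
  end.

(** * Linear extension from a basis and shuffle sums *)

(* Both are locked: failing conversion tests would otherwise unfold finite
   supports. *)
HB.lock Definition mono (K : fieldType) (X : choiceType) (x : X) :
  {malg K[X]} := << x >>.

HB.lock Definition lext (K : fieldType) (X : choiceType) (V : lmodType K)
  (f : X -> V) (z : {malg K[X]}) : V := \sum_(k <- msupp z) z@_k *: f k.

Arguments mono {K X} x.

Section LinearExtension.
Context (K : fieldType) (X : choiceType) (V : lmodType K).
Implicit Types (f g : X -> V) (z : {malg K[X]}).

(** Sums over different supports can thus be taken over a common finite set. *)
Lemma lextEw f z (d : {fset X}) : (msupp z `<=` d)%fset ->
  lext f z = \sum_(k <- d) z@_k *: f k.
Proof.
move=> le; rewrite lext.unlock (big_fset_incl _ le) //.
by move=> k _ /mcoeff_outdom ->; rewrite scale0r.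
Qed.

Lemma lext_is_linear f : linear (lext f).
Proof.
move=> a u v; pose d := (msupp u `|` msupp v)%fset.
have lu : (msupp u `<=` d)%fset by apply: fsubsetUl.
have lv : (msupp v `<=` d)%fset by apply: fsubsetUr.
rewrite !(@lextEw f _ d) //; last first.
  apply: fsubset_trans (msuppD_le _ _) _; apply: fsetSU; exact: msuppZ_le.
rewrite scaler_sumr -big_split; apply: eq_bigr => k _ /=.
by rewrite mcoeffD mcoeffZ scalerDl scalerA.
Qed.

HB.instance Definition _ f :=
  GRing.isLinear.Build K {malg K[X]} V *:%R (lext f) (lext_is_linear f).

Lemma lextU f c k : lext f << c *g k >> = c *: f k.
Proof.
rewrite (@lextEw f _ [fset k]%fset) ?msuppU_le //.
by rewrite big_seq_fset1 mcoeffUU.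
Qed.

Lemma lext_mono f k : lext f (mono k) = f k.
Proof. by rewrite mono.unlock lextU scale1r. Qed.

Lemma eq_in_lext f g z : {in msupp z, f =1 g} -> lext f z = lext g z.
Proof. by rewrite lext.unlock => fg; apply: eq_big_seq => k hk; rewrite fg. Qed.

Lemma eq_lext f g z : f =1 g -> lext f z = lext g z.
Proof. by move=> fg; apply: eq_in_lext => k _. Qed.

Lemma lextDf f g z : lext (fun k => f k + g k) z = lext f z + lext g z.
Proof. by rewrite lext.unlock -big_split; apply: eq_bigr => k _;
  rewrite scalerDr. Qed.

Lemma lextZf a f z : lext (fun k => a *: f k) z = a *: lext f z.
Proof.
by rewrite lext.unlock scaler_sumr; apply: eq_bigr => k _; rewrite !scalerA mulrC.
Qed.

Lemma lext0f z : lext (fun=> 0 : V) z = 0.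
Proof. by rewrite lext.unlock big1 // => k _; rewrite scaler0. Qed.

End LinearExtension.

Lemma lext_basis (K : fieldType) (X : choiceType) (z : {malg K[X]}) :
  lext mono z = z.
Proof.
rewrite lext.unlock mono.unlock [RHS]monalgE; apply: eq_bigr => k _.
by apply/malgP => k'; rewrite mcoeffZ !mcoeffU mulrnAr mulr1.
Qed.

Section LinearMaps.
Context (K : fieldType) (V V' : lmodType K) (f : V -> V') (lf : linear f).

Let fL : {linear V -> V'} := HB.pack f (GRing.isLinear.Build K V V' *:%R f lf).

Lemma lin0 : f 0 = 0. Proof. exact: (linear0 fL). Qed.
Lemma linN u : f (- u) = - f u. Proof. exact: (linearN fL). Qed.
Lemma linD u v : f (u + v) = f u + f v. Proof. exact: (linearD fL). Qed.
Lemma linB u v : f (u - v) = f u - f v. Proof. exact: (linearB fL). Qed.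
Lemma linZ a u : f (a *: u) = a *: f u. Proof. exact: (linearZ_LR fL). Qed.
Lemma lin_sum I (r : seq I) P F :
  f (\sum_(i <- r | P i) F i) = \sum_(i <- r | P i) f (F i).
Proof. exact: (linear_sum fL). Qed.

End LinearMaps.

Lemma linear_lext (K : fieldType) (X : choiceType) (V V' : lmodType K)
    (phi : V -> V') (f : X -> V) (z : {malg K[X]}) :
  linear phi -> phi (lext f z) = lext (fun k => phi (f k)) z.
Proof.
move=> lphi; rewrite !lext.unlock (lin_sum lphi); apply: eq_bigr => k _.
exact: linZ.
Qed.

Lemma lext_lext (K : fieldType) (X Y : choiceType) (V : lmodType K)
    (f : Y -> V) (g : X -> {malg K[Y]}) (z : {malg K[X]}) :
  lext f (lext g z) = lext (fun k => lext f (g k)) z.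
Proof. exact/linear_lext/lext_is_linear. Qed.

Lemma lext_ind (K : fieldType) (X : choiceType) (P : {malg K[X]} -> Prop) z :
  P 0 -> (forall a u v, P u -> P v -> P (a *: u + v)) ->
  {in msupp z, forall k, P (mono k)} -> P z.
Proof.
move=> P0 PD Pz; rewrite -(lext_basis z) lext.unlock.
have: {subset enum_fset (msupp z) <= msupp z} by [].
elim: (enum_fset (msupp z)) => [|k s IH] hs; first by rewrite big_nil.
rewrite big_cons; apply: PD; first by apply/Pz/hs; rewrite inE eqxx.
by apply: IH => k' hk'; apply: hs; rewrite inE hk' orbT.
Qed.

Lemma msupp_mono (K : fieldType) (X : choiceType) (x y : X) :
  y \in msupp (mono x : {malg K[X]}) -> y = x.
Proof.
by rewrite mono.unlock => /(fsubsetP (msuppU_le)); rewrite inE => /eqP.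
Qed.

Lemma msupp_lext (K : fieldType) (X Y : choiceType) (f : X -> {malg K[Y]}) z
    (P : Y -> Prop) :
  {in msupp z, forall k, {in msupp (f k), forall j, P j}} ->
  {in msupp (lext f z), forall j, P j}.
Proof.
move=> h j; rewrite -mcoeff_neq0 lext.unlock => hj.
apply: contrapT => nP; move/eqP: hj; apply.
rewrite raddf_sum big1_seq //= => k hk; rewrite mcoeffZ.
have [hj|/mcoeff_outdom ->] := boolP (j \in msupp (f k)); last by rewrite mulr0.
by case: nP; apply: h hk _ hj.
Qed.

(* The convolution of functions on words dual to the unshuffle coproduct:
   phi is summed over all ways to split N into two complementary subwords. *)
Section Shuffle.
Context (K : fieldType) (T : eqType) (V : lmodType K).
Implicit Types (phi psi : seq T -> seq T -> V) (N : seq T).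

Fixpoint shuf phi N : V :=
  if N is k :: N' then
    shuf (fun a b => phi (k :: a) b) N' + shuf (fun a b => phi a (k :: b)) N'
  else phi [::] [::].

(** Only subwords of [N] enter, so sortedness and lower bounds of [N] pass to both arguments. *)
Lemma eq_in_shuf phi psi N :
  (forall a b, subseq a N -> subseq b N -> phi a b = psi a b) ->
  shuf phi N = shuf psi N.
Proof.
elim: N phi psi => [|k N IH] phi psi h /=; first exact: h.
by congr (_ + _); apply: IH => a b ha hb; apply: h => //=; rewrite ?eqxx //;
  apply: (subseq_trans _ (subseq_cons _ _)).
Qed.

Lemma eq_shuf phi psi N : (forall a b, phi a b = psi a b) ->
  shuf phi N = shuf psi N.
Proof. by move=> h; apply: eq_in_shuf. Qed.

Lemma shufD phi psi N :
  shuf (fun a b => phi a b + psi a b) N = shuf phi N + shuf psi N.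
Proof. by elim: N phi psi => [|k N IH] phi psi //=; rewrite !IH addrACA. Qed.

Lemma shufZ c phi N : shuf (fun a b => c *: phi a b) N = c *: shuf phi N.
Proof. by elim: N phi => [|k N IH] phi //=; rewrite !IH scalerDr. Qed.

Lemma shuf0 N : shuf (fun _ _ => 0) N = 0.
Proof. by elim: N => [|k N IH] //=; rewrite IH addr0. Qed.

Lemma lext_shuf (X : choiceType) (f : X -> seq T -> seq T -> V)
    (z : {malg K[X]}) N :
  lext (fun x => shuf (f x) N) z = shuf (fun a b => lext (fun x => f x a b) z) N.
Proof. by elim: N f => [|k N IH] f //=; rewrite lextDf !IH. Qed.

End Shuffle.

Lemma linear_shuf (K : fieldType) (T : eqType) (V V' : lmodType K)
    (h : V -> V') (phi : seq T -> seq T -> V) N :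
  linear h -> h (shuf phi N) = shuf (fun a b => h (phi a b)) N.
Proof.
by move=> lh; elim: N phi => [|k N IH] phi //=; rewrite linD // !IH.
Qed.

(** * The Poincare-Birkhoff-Witt action on sorted words *)

(* The choice structure on words is given explicitly because the elaboration of
   [{malg K[seq T]}] inserts reverse coercions that hinder syntactic matching. *)
Notation word_span K T := {malg K[Datatypes_list__canonical__choice_Choice T]}.

(* Functions of a word N defined from their values on strictly shorter words:
   [step n A] computes the values at length n.+1 from those, given by [A], at
   length at most n. *)
Section Grow.
Context (T : Type) (V : Type) (v0 : V).
Variable step : nat -> (T -> seq T -> V) -> T -> seq T -> V.

Fixpoint grow n : T -> seq T -> V :=
  if n is m.+1 then
    fun i N => if (size N <= m)%N then grow m i N else step m (grow m) i N
  (* At level 0 only the empty word matters; there both recursions below return a value without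
     consulting [v0]. *)
  else step 0 (fun _ _ => v0).

Definition grown i N := grow (size N) i N.

Lemma growE n i N : (size N <= n)%N -> grow n i N = grown i N.
Proof.
elim: n => [|n IH] /=; first by case: N.
rewrite leq_eqVlt ltnS => /orP[/eqP e|h]; last by rewrite h IH.
by rewrite /grown e /= e ltnn.
Qed.

Lemma grown_cons i k N : grown i (k :: N) = step (size N) (grow (size N)) i (k :: N).
Proof. by rewrite /grown /= ltnn. Qed.

End Grow.

Section PBW.
Context (K : fieldType) (B : lieAlgType K).
Context (T : choiceType) (le : rel T).
Hypotheses (le_total : total le) (le_trans : transitive le)
  (le_anti : antisymmetric le).
Context (bas : T -> B) (co : B -> {malg K[T]}).
Hypotheses (co_linear : linear co) (co_bas : forall t, co (bas t) = mono t)
  (bas_co : forall b, lext bas (co b) = b).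

Local Notation S := (word_span K T).
Local Notation srt := (sorted le).

Let le_refl : reflexive le.
Proof. by move=> i; have := le_total i i; rewrite orbb. Qed.

Lemma lin_basis_ext (V : lmodType K) (f g : B -> V) :
  linear f -> linear g -> (forall t, f (bas t) = g (bas t)) -> f =1 g.
Proof.
move=> lf lg h b; rewrite -(bas_co b) !(linear_lext _ _ lf, linear_lext _ _ lg).
exact: eq_lext.
Qed.

Definition below i (N : seq T) := all (le i) N.

Lemma srt_cons i N : srt (i :: N) = below i N && srt N.
Proof. exact: (path_sortedE le_trans). Qed.

Lemma below_hd i k N : srt (k :: N) -> le i k -> below i (k :: N).
Proof.
rewrite srt_cons /below /= => /andP[h _] ik; rewrite ik /=.
by apply: sub_all h => j; apply: le_trans.
Qed.

(** Length filtration: b_i N consists of sorted words at most one letter longer than N. Those of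
    maximal length keep every lower bound k of N with k <= i, so b_k acts on them by prefixing k. *)
Definition pbw_supp i N J := srt J /\
  ((size J <= size N)%N \/
   [/\ size J = (size N).+1, below i N -> below i J &
       forall k, le k i -> below k N -> below k J]).

Record pbw_action (Act : B -> S -> S) : Prop := PbwAction {
  Act_linearl : forall z, linear (Act^~ z);
  Act_linearr : forall b, linear (Act b);
  Act_min : forall i N, below i N -> Act (bas i) (mono N) = mono (i :: N);
  Act_supp : forall i N, srt N ->
    {in msupp (Act (bas i) (mono N)), forall J, pbw_supp i N J};
  Act_cons : forall i k N, srt (k :: N) -> ~~ le i k ->
    Act (bas i) (mono (k :: N)) =
    Act (bas k) (Act (bas i) (mono N)) + Act (lie (bas i) (bas k)) (mono N)
}.

Section Construction.

(* For k minimal in k :: N and i > k, [b_i (k N) = b_k (b_i N) + [b_i, b_k] N];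
   the words of [b_i N] of maximal length are prefixed with k directly. *)
Definition act_step n (A : T -> seq T -> S) i N : S :=
  if N is k :: N' then
    if le i k then (mono (i :: N)) else
      lext (fun J => if (size J <= n)%N then A k J else (mono (k :: J))) (A i N')
      + lext (A^~ N') (co (lie (bas i) (bas k)))
  else (mono [:: i]).

Definition bact := grown 0 act_step.

Definition act (b : B) (z : S) : S := lext (fun t => lext (bact t) z) (co b).

Lemma actE b z : act b z = lext (fun t => lext (bact t) z) (co b).
Proof. by []. Qed.

Lemma act_bas i N : act (bas i) (mono N) = bact i N.
Proof. by rewrite actE co_bas !lext_mono. Qed.

Lemma act_linearr b : linear (act b).
Proof.
move=> a u v; rewrite actE -lextZf -lextDf; apply: eq_lext => t.
exact: lext_is_linear.
Qed.

Lemma act_linearl z : linear (act^~ z).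
Proof. by move=> a b c; rewrite actE co_linear lext_is_linear. Qed.

Lemma bact_min i N : below i N -> bact i N = (mono (i :: N)).
Proof.
by case: N => [|k N] //=; rewrite /bact grown_cons /= => /andP[-> _].
Qed.

Lemma bact_suppP i N : srt N -> {in msupp (bact i N), forall J, pbw_supp i N J}.
Proof.
have [n] := ubnP (size N); elim: n i N => // n IH i N.
have base J : srt (i :: N) -> J \in msupp (mono (i :: N) : S) -> pbw_supp i N J.
  move=> h /msupp_mono ->; split=> //; right.
  split=> //= [|k ki]; rewrite /below /=; first by rewrite le_refl.
  by move=> ->; rewrite ki.
case: N base => [|k N] base; first by move=> _ _ J; apply: base.
rewrite ltnS => hN hs J; rewrite /bact grown_cons /=.
case: ifPn => [ik|nik].
  by apply: base; rewrite srt_cons hs below_hd.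
have hs' : srt N by move: hs; rewrite srt_cons => /andP[].
move=> /(fsubsetP (msuppD_le _ _)); rewrite inE => /orP[]; last first.
  apply: msupp_lext J => t _ J; rewrite growE // => /IH[] //= sJ hJ.
  split=> //; left; case: hJ => [/leqW//|[-> _ _]//].
apply: msupp_lext J => J'; rewrite growE // => /IH[] //= sJ' hJ' J.
case: ifPn => [h|h].
  rewrite growE // => /IH[] //; first exact: leq_ltn_trans hN.
  move=> sJ hJ; split=> //; left => /=.
  by case: hJ => [h'|[-> _ _]//]; apply: leq_trans h' _; apply: leqW.
(* A longest word J' of b_i N gets the prefix k; the result is sorted because J' is still bounded
   below by k. *)
case: hJ' h => [->//|[sz b1 b2] _].
move=> /msupp_mono ->.
have ki : le k i by case/orP: (le_total i k) nik => ->.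
have kN : below k N by move: hs; rewrite srt_cons => /andP[].
split; first by rewrite srt_cons sJ' b2.
right; split=> //=; first by rewrite sz.
  by rewrite /below /= (negbTE nik).
by rewrite /below /= => k' k'i /andP[-> hN'] /=; apply: b2.
Qed.

(** The direct prefixing in [act_step] agrees with the action of b_k: by [bact_suppP] the longest
    words of b_i N still have k as a lower bound. *)
Lemma bact_cons i k N : srt (k :: N) -> ~~ le i k ->
  bact i (k :: N) = act (bas k) (bact i N) + act (lie (bas i) (bas k)) (mono N).
Proof.
move=> hs nik; rewrite {1}/bact grown_cons /= (negbTE nik); congr (_ + _).
  rewrite actE co_bas lext_mono growE //.
  apply: eq_in_lext => J hJ; case: ifPn => h; first by rewrite growE.
  have hs' : srt N by move: hs; rewrite srt_cons => /andP[].
  case: (bact_suppP hs' hJ) h => _ [->//|[_ _ b2] _].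
  rewrite bact_min // b2 //; first by case/orP: (le_total i k) nik => ->.
  by move: hs; rewrite srt_cons => /andP[].
by apply: eq_lext => t; rewrite growE // lext_mono.
Qed.

Lemma pbw_action_exists : exists Act, pbw_action Act.
Proof.
exists act; split=> [z|b|i N iN|i N hs J|i k N hs nik].
- exact: act_linearl.
- exact: act_linearr.
- by rewrite act_bas bact_min.
- by rewrite act_bas; apply: bact_suppP.
- by rewrite !act_bas bact_cons.
Qed.

End Construction.

Context (Act : B -> S -> S) (hAct : pbw_action Act).

Let linl := Act_linearl hAct.
Let linr := Act_linearr hAct.
Let Amin := Act_min hAct.
Let Asupp := Act_supp hAct.
Let Acons := Act_cons hAct.

Definition ActDl b c z : Act (b + c) z = Act b z + Act c z :=
  linD (linl z) b c.
Definition ActNl b z : Act (- b) z = - Act b z := linN (linl z) b.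
Definition Act0l z : Act 0 z = 0 := lin0 (linl z).

Definition act_comm_at b c z := Act b (Act c z) - Act c (Act b z) = Act (lie b c) z.

Lemma act_comm_atC b c z : act_comm_at b c z -> act_comm_at c b z.
Proof. by rewrite /act_comm_at => h; rewrite lieC ActNl -h opprB. Qed.

(** One of b_i, b_j acts on N by prefixing the smaller letter; the recursion for the other one on
    the prefixed word is then the claim. *)
Lemma act_comm_at_min i j N : srt N -> below i N ->
  act_comm_at (bas i) (bas j) (mono N).
Proof.
move=> hs iN; rewrite /act_comm_at.
have [->|ij] := eqVneq i j; first by rewrite subrr liexx Act0l.
have hiN : srt (i :: N) by rewrite srt_cons iN.
have [ji|nji] := boolP (le j i).
  have nij : ~~ le i j.
    by apply: contra ij => ij; apply/eqP/le_anti; rewrite ij ji.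
  have jN : below j N by apply: sub_all iN => k; apply: le_trans.
  rewrite (Amin jN) Acons //; last by rewrite srt_cons jN.
  zmod.
rewrite (Amin iN) (Acons hiN nji) [lie (bas i) _]lieC ActNl; zmod.
Qed.

Lemma act_comm_at_lext b c z :
  {in msupp z, forall J, act_comm_at b c (mono J)} -> act_comm_at b c z.
Proof.
move=> h; apply: lext_ind => [|a u v hu hv|//];
  first by rewrite /act_comm_at !(lin0 (linr _)) subrr.
move: hu hv; rewrite /act_comm_at !linr => <- <-.
rewrite scalerBr; zmod.
Qed.

(** The defect [f] is antisymmetric, so linearity in its first argument reduces both arguments to
    the basis. *)
Lemma act_comm_at_basis N : (forall i j, act_comm_at (bas i) (bas j) (mono N)) ->
  forall b c, act_comm_at b c (mono N).
Proof.
move=> h b c; rewrite /act_comm_at.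
pose f b c := Act b (Act c (mono N)) - Act c (Act b (mono N))
  - Act (lie b c) (mono N).
suff: f b c = 0 by move/eqP; rewrite subr_eq0 => /eqP.
have fl c' : linear (f^~ c').
  move=> a u v; rewrite /f lie_linearl !linl !linr !scalerBr; zmod.
have fC u v : f u v = - f v u.
  by rewrite /f lieC ActNl; zmod.
have l0 : linear (fun _ : B => 0 : S) by move=> a u v; rewrite scaler0 addr0.
apply: (lin_basis_ext (fl c) l0) => i; rewrite fC.
rewrite (lin_basis_ext (fl _) l0) ?oppr0 // => j.
by rewrite /f h subrr.
Qed.

(* By induction on the length: when k is smaller than i and j, move b_k to the
   left of both and use the Jacobi identity. *)
Lemma Act_comm N : srt N -> forall b c, act_comm_at b c (mono N).
Proof.
have [n] := ubnP (size N); elim: n N => // n IH N; rewrite ltnS => hN hs.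
apply: act_comm_at_basis => i j.
have [iN|niN] := boolP (below i N); first exact: act_comm_at_min.
have [jN|njN] := boolP (below j N); first exact/act_comm_atC/act_comm_at_min.
case: N => [//|k N] in hN hs niN njN *.
have ki : ~~ le i k by apply: contra niN; apply: below_hd.
have kj : ~~ le j k by apply: contra njN; apply: below_hd.
have [kN sN] : below k N /\ srt N by apply/andP; rewrite -srt_cons.
have IHz z : {in msupp z, forall J, srt J /\ (size J <= size N)%N} ->
    forall b c, act_comm_at b c z.
  move=> h b c; apply: act_comm_at_lext => J /h[sJ lJ]; apply: IH => //.
  exact: leq_ltn_trans hN.
have IHN : forall b c, act_comm_at b c (mono N).
  by apply: IHz => J /msupp_mono ->.
(* The shorter words of b_l' N fall under the induction; the longest ones keep k as a lower
   bound. *)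
have kC l l' : ~~ le l k -> ~~ le l' k ->
  act_comm_at (bas l) (bas k) (Act (bas l') (mono N)).
  move=> nl nl'; apply: act_comm_at_lext => J /Asupp[] // sJ.
  case=> [lJ|[_ _ h]]; first by apply: IH => //; exact: leq_ltn_trans hN.
  apply/act_comm_atC/act_comm_at_min => //; apply: h => //.
  by case/orP: (le_total l' k) nl' => ->.
have swap b c z : act_comm_at b c z ->
  Act b (Act c z) = Act c (Act b z) + Act (lie b c) z.
  by move=> <-; rewrite addrC subrK.
rewrite /act_comm_at !Acons // !(linD (linr _)).
rewrite (swap (bas i) (bas k) (Act (bas j) (mono N)) (kC i j ki kj)).
rewrite (swap (bas j) (bas k) (Act (bas i) (mono N)) (kC j i kj ki)).
rewrite (swap (bas i) (lie (bas j) (bas k)) (mono N)) //.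
rewrite (swap (bas j) (lie (bas i) (bas k)) (mono N)) //.
(* Commute b_i with b_j on N, then b_k with [b_i, b_j] on N, and use b_k N = k N. *)
have e1 : Act (bas k) (Act (bas i) (Act (bas j) (mono N)))
    - Act (bas k) (Act (bas j) (Act (bas i) (mono N))) =
    Act (lie (bas i) (bas j)) (mono (k :: N))
      + Act (lie (bas k) (lie (bas i) (bas j))) (mono N).
  rewrite -(linB (linr _)) (IHN (bas i) (bas j)).
  by rewrite (swap (bas k) (lie (bas i) (bas j)) (mono N)) // Amin.
have e2 : Act (lie (bas k) (lie (bas i) (bas j))) (mono N) =
   Act (lie (bas j) (lie (bas i) (bas k))) (mono N)
   - Act (lie (bas i) (lie (bas j) (bas k))) (mono N).
  rewrite -ActNl -ActDl; congr (Act _ _).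
  have := lie_jacobi (bas i) (bas j) (bas k).
  rewrite (lieC (bas k) (bas i)) lieNr => /eqP; rewrite addrC addr_eq0 => /eqP ->.
  by rewrite opprB.
move/eqP: e1; rewrite e2 subr_eq => /eqP ->.
zmod.
Qed.

Lemma lext_Act (V : lmodType K) (f : seq T -> V) b z :
  lext f (Act b z) = lext (fun J => lext f (Act b (mono J))) z.
Proof.
rewrite -lext_lext -(linear_lext _ _ (linr b)); congr (lext f (Act b _)).
by rewrite lext_basis.
Qed.

(* B acts by coderivations of the unshuffle coproduct, in dual form. *)
Section Coderivation.
Context (V : lmodType K).
Implicit Type phi : seq T -> seq T -> V.

Definition dAct b phi x y :=
  lext (phi^~ y) (Act b (mono x)) + lext (phi x) (Act b (mono y)).

Lemma srt_subseq N a : srt N -> subseq a N -> srt a.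
Proof. by move=> hs ha; apply: (subseq_sorted le_trans ha). Qed.

Lemma below_subseq k N a : below k N -> subseq a N -> below k a.
Proof. by move=> /allP h /mem_subseq ha; apply/allP => j /ha /h. Qed.

Lemma dAct_linear phi x y : linear (fun b => dAct b phi x y).
Proof.
move=> c u v; rewrite /dAct !(linl _ c) !lext_is_linear scalerDr; zmod.
Qed.

(** Strong induction on the length, with b in the basis by linearity. For i minimal both sides
    prefix i to one of the two subwords; otherwise [Acons] is unfolded on N and on its subwords
    alike. *)
Lemma Act_shuf phi b N : srt N ->
  lext (shuf phi) (Act b (mono N)) = shuf (dAct b phi) N.
Proof.
have [n] := ubnP (size N); elim: n b N phi => // n IH b N phi; rewrite ltnS => hN hs.
apply: (lin_basis_ext (f := fun b => lext (shuf phi) (Act b (mono N)))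
  (g := fun b => shuf (dAct b phi) N)) => [c u v|c u v|i] /=.
- by rewrite (linl _ c) lext_is_linear.
- by rewrite -shufZ -shufD; apply: eq_shuf => x y; rewrite dAct_linear.
have [iN|niN] := boolP (below i N).
  rewrite Amin // lext_mono /= -shufD; apply: eq_in_shuf => x y hx hy.
  by rewrite /dAct !Amin ?(below_subseq iN) // !lext_mono.
case: N => [//|k N] in hN hs niN *.
have ki : ~~ le i k by apply: contra niN; apply: below_hd.
have [kN sN] : below k N /\ srt N by apply/andP; rewrite -srt_cons.
have bk a : subseq a N -> Act (bas k) (mono a) = (mono (k :: a)).
  by move=> ha; rewrite Amin // (below_subseq kN).
have bi a : subseq a N -> Act (bas i) (mono (k :: a)) =
    Act (bas k) (Act (bas i) (mono a)) + Act (lie (bas i) (bas k)) (mono a).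
  move=> ha; rewrite Acons // srt_cons (below_subseq kN) //.
  exact: srt_subseq ha.
rewrite bi // (linD (lext_is_linear _)) /= lext_Act IH // -shufD.
(* On the words of b_i N the claim for b_k holds by induction if they are short, and by prefixing k
   if they are longest. *)
transitivity (lext (shuf (dAct (bas k) phi)) (Act (bas i) (mono N))
    + shuf (dAct (lie (bas i) (bas k)) phi) N).
  congr (_ + _); apply: eq_in_lext => J /Asupp[] // sJ.
  case=> [lJ|[_ _ h]]; first by rewrite IH // (leq_ltn_trans _ hN).
  have kJ : below k J by apply: h => //; case/orP: (le_total i k) ki => ->.
  rewrite Amin // lext_mono /= -shufD; apply: eq_in_shuf => x y hx hy.
  by rewrite /dAct !Amin ?(below_subseq kJ) // !lext_mono.
rewrite IH // -shufD; apply: eq_in_shuf => x y hx hy.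
rewrite /dAct !bi // !lextDf !(linD (lext_is_linear _)) (lext_Act (phi^~ y) (bas k)
  (Act _ _)) (lext_Act (phi x) (bas k) (Act _ _)) !bk //.
have -> : lext (fun J => lext (phi J) (mono (k :: y))) (Act (bas i) (mono x)) =
    lext (phi^~ (k :: y)) (Act (bas i) (mono x)).
  by apply: eq_lext => J; rewrite lext_mono.
have -> : lext (fun J => lext (phi^~ J) (mono (k :: x))) (Act (bas i) (mono y)) =
    lext (phi (k :: x)) (Act (bas i) (mono y)).
  by apply: eq_lext => J; rewrite lext_mono.
zmod.
Qed.

End Coderivation.

(* The recursion satisfied by the functions a_i of [basis_lift_word] below. *)
Section Cocycle.
Context (V : lmodType K) (f : T -> T -> seq T -> V).

Definition coc_step n (A : T -> seq T -> V) i N : V :=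
  if N is k :: N' then
    if le i k then 0 else
      lext (fun J => if (size J <= n)%N then A k J else 0) (Act (bas i) (mono N'))
      + lext (A^~ N') (co (lie (bas i) (bas k))) + f i k N'
  else 0.

Definition coc := grown 0 coc_step.

Lemma coc_min i N : below i N -> coc i N = 0.
Proof.
by case: N => [|k N] //=; rewrite /coc grown_cons /= => /andP[-> _].
Qed.

(** The words cut off in [coc_step] are the longest ones of b_i N; k bounds them below, and there
    [coc k] vanishes. *)
Lemma coc_cons i k N : srt (k :: N) -> ~~ le i k ->
  coc i (k :: N) = lext (coc k) (Act (bas i) (mono N))
    + lext (coc^~ N) (co (lie (bas i) (bas k))) + f i k N.
Proof.
move=> hs nik; rewrite {1}/coc grown_cons /= (negbTE nik); congr (_ + _ + _).
apply: eq_in_lext => J hJ; case: ifPn => h; first by rewrite growE.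
have hs' : srt N by move: hs; rewrite srt_cons => /andP[].
case: (Asupp hs' hJ) h => _ [->//|[_ _ b2] _].
rewrite coc_min // b2 //; first by case/orP: (le_total i k) nik => ->.
by move: hs; rewrite srt_cons => /andP[].
Qed.

End Cocycle.

End PBW.

(** * The connection of a lift of the basis *)

Section Connection.
Context (K : fieldType) (L : lieAlgType K) (M : lieIdeal L).
Local Notation B := (quotlie M).
Context (T : choiceType) (le : rel T).
Hypotheses (le_total : total le) (le_trans : transitive le).
Context (bas : T -> B) (co : B -> {malg K[T]}).
Hypothesis bas_co : forall b, lext bas (co b) = b.
Context (F : algType K) (iota : L -> F) (hiota : lie_assoc_hom iota).

Local Notation pi := (qpi M : L -> B).
Local Notation srt := (sorted le).

Local Notation S := (word_span K T).
Context (Act : B -> S -> S) (hAct : pbw_action le bas Act).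

Definition basis_lift (t : T) : L := qrepr (bas t).

Lemma pi_basis_lift t : pi (basis_lift t) = bas t.
Proof. exact: qreprK. Qed.

Lemma pi_linear : linear pi. Proof. exact: qpi_linear. Qed.

Lemma pi_lie l l' : pi (lie l l') = lie (pi l) (pi l').
Proof. by rewrite -[RHS]/(quot_lie _ _) qpi_lie. Qed.

(** A linear section of [pi]; below, [rest] is the complementary component in M, so l =
    [sect (pi l)] + [rest l]. *)
Definition sect (b : B) : L := lext basis_lift (co b).

Lemma rest_subproof l : l - sect (pi l) \in ideal_subalg M.
Proof.
apply/qpiP; rewrite /sect (linear_lext _ _ pi_linear) -[LHS](bas_co (pi l)).
by apply: eq_lext => t; rewrite pi_basis_lift.
Qed.

Definition rest l : sublie M := Sublie (rest_subproof l).

Lemma ideal_lie_subproof (m : sublie M) l : lie (val m) l \in ideal_subalg M.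
Proof. exact: (@rpred_liel _ _ M _ l (valP m)). Qed.

Definition ideal_lie (m : sublie M) l : sublie M := Sublie (ideal_lie_subproof m l).

(** The iterated bracket [...[m, xi_k1], ..., xi_kn], which stays in the ideal. *)
Fixpoint ad_word (m : sublie M) N : sublie M :=
  if N is k :: N' then ad_word (ideal_lie m (basis_lift k)) N' else m.

Definition lift_word N : F := \prod_(t <- N) iota (basis_lift t).

Lemma lift_word_cons k N : lift_word (k :: N) = iota (basis_lift k) * lift_word N.
Proof. by rewrite /lift_word big_cons. Qed.

(** The inhomogeneous term is the component of [xi_i, xi_k] in M, the curvature of the section,
    bracketed with the remaining lifts. *)
Definition lift_coc := coc le bas co Act (fun i k =>
  ad_word (rest (lie (basis_lift i) (basis_lift k)))).

(* The M-valued function a_l such that, for the products s(N) of lifts,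
   [l s(N) = s(pi l . N) + sum s(N') a_l(N'')]; see [iota_lift_word]. *)
Definition conn l N : sublie M := lext (lift_coc^~ N) (co (pi l))
  + ad_word (rest l) N.

Definition word_mul (a : seq T -> sublie M) : seq T -> seq T -> F :=
  fun x y => lift_word x * iota (val (a y)).

Lemma mulr_linear (u : F) : linear (fun x : F => u * x).
Proof. by move=> a v w; rewrite mulrDr scalerAr. Qed.

Lemma mull_linear (u : F) : linear (fun x : F => x * u).
Proof. by move=> a v w; rewrite mulrDl scalerAl. Qed.

Lemma iotav_linear : linear (fun m : sublie M => iota (val m)).
Proof. by move=> a u v; rewrite /= hiota.1. Qed.

Lemma word_mul_linear x : linear (fun m : sublie M => lift_word x * iota (val m)).
Proof. by move=> a u v; rewrite iotav_linear mulr_linear. Qed.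

Lemma iota_swap u v (w : F) :
  iota u * (iota v * w) = iota v * (iota u * w) + iota (lie u v) * w.
Proof. by rewrite hiota.2 mulrBl !mulrA; zmod. Qed.

(** Moving m to the right end, each lift is either passed or absorbed into a bracket with m; these
    choices are the splittings of N. *)
Lemma ad_word_lift m N : iota (val m) * lift_word N = shuf (word_mul (ad_word m)) N.
Proof.
elim: N m => [|k N IH] m /=;
  first by rewrite /word_mul /lift_word big_nil mulr1 mul1r.
rewrite lift_word_cons iota_swap; congr (_ + _);
  last exact: (IH (ideal_lie m (basis_lift k))).
rewrite IH (linear_shuf _ _ (mulr_linear _)); apply: eq_shuf => x y.
by rewrite /word_mul lift_word_cons mulrA.
Qed.

(** Linear extension from the lifts takes care of [sect (pi l)], and [ad_word_lift] of the component
    in M. *)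
Lemma conn_lift_word l N :
  (forall t, iota (basis_lift t) * lift_word N =
     lext lift_word (Act (bas t) (mono N)) + shuf (word_mul (lift_coc t)) N) ->
  iota l * lift_word N = lext lift_word (Act (pi l) (mono N))
    + shuf (word_mul (conn l)) N.
Proof.
move=> h; rewrite -{1}[l](subrK (sect (pi l))) (linD hiota.1) mulrDl.
rewrite -[l - _]/(val (rest l)) ad_word_lift /sect (linear_lext _ _ hiota.1).
rewrite (linear_lext _ _ (mull_linear _)).
under eq_lext => t do rewrite h.
rewrite lextDf lext_shuf addrC -addrA; congr (_ + _).
  rewrite -{2}[pi l]bas_co (linear_lext _ _ (Act_linearl hAct _)).
  by rewrite (linear_lext _ _ (lext_is_linear _)).
rewrite -shufD; apply: eq_shuf => x y.
by rewrite /word_mul /conn -(linear_lext _ _ (word_mul_linear x)) -mulrDr -(linD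
  iotav_linear).
Qed.

(** Strong induction on the length. If k is the first letter and k < i, write xi_i xi_k = xi_k xi_i
    + [xi_i, xi_k] and apply the induction to the rest; the terms with values in M add up to the
    recursion [coc_cons]. *)
Lemma basis_lift_word i N : srt N -> iota (basis_lift i) * lift_word N =
  lext lift_word (Act (bas i) (mono N)) + shuf (word_mul (lift_coc i)) N.
Proof.
have [n] := ubnP (size N); elim: n i N => // n IH i N; rewrite ltnS => hN hs.
have min k J : below le k J -> iota (basis_lift k) * lift_word J =
  lext lift_word (Act (bas k) (mono J)) + shuf (word_mul (lift_coc k)) J.
  move=> kJ; rewrite (Act_min hAct) // lext_mono lift_word_cons.
  rewrite (eq_in_shuf (psi := fun _ _ => 0)) ?shuf0 ?addr0 // => x y _ hy.
  by rewrite /word_mul /lift_coc coc_min ?(below_subseq kJ hy) // (lin0 hiota.1)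
    mulr0.
have [iN|niN] := boolP (below le i N); first exact: min.
case: N => [//|k N] in hN hs niN *.
have ki : ~~ le i k by apply: contra niN; apply: below_hd.
have [kN sN] : below le k N /\ srt N by apply/andP; rewrite -srt_cons.
have bas_lie u v : lie (bas u) (bas v) = pi (lie (basis_lift u) (basis_lift v)).
  by rewrite pi_lie !pi_basis_lift.
rewrite lift_word_cons iota_swap (Act_cons hAct) //.
have -> : iota (lie (basis_lift i) (basis_lift k)) * lift_word N =
    lext lift_word (Act (lie (bas i) (bas k)) (mono N))
    + shuf (word_mul (conn (lie (basis_lift i) (basis_lift k)))) N.
  by rewrite bas_lie; apply: conn_lift_word => t; apply: IH.
rewrite (IH i N) // mulrDr (linear_lext _ _ (mulr_linear _)).
rewrite (linear_shuf _ _ (mulr_linear _)).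
(* Multiply each s(J), for J in b_i N, by xi_k, then distribute b_i over the splitting of N by
   [Act_shuf]. *)
have -> : lext (fun J => iota (basis_lift k) * lift_word J) (Act (bas i) (mono N)) =
    lext lift_word (Act (bas k) (Act (bas i) (mono N)))
    + shuf (fun x y => word_mul (fun y =>
      lext (lift_coc k) (Act (bas i) (mono y))) x y) N.
  transitivity (lext (fun J => lext lift_word (Act (bas k) (mono J))
      + shuf (word_mul (lift_coc k)) J) (Act (bas i) (mono N))).
    apply: eq_in_lext => J /(Act_supp hAct)[] // sJ [lJ|[_ _ h]].
      by rewrite IH // (leq_ltn_trans _ hN).
    by rewrite min ?(Act_min hAct) ?h //; case/orP: (le_total i k) ki => ->.
  rewrite lextDf -(lext_Act hAct); congr (_ + _).
  rewrite -[LHS]/(lext (shuf (word_mul (lift_coc k))) _).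
  rewrite (Act_shuf le_total le_trans bas_co hAct) //;
    apply: eq_in_shuf => x y hx hy.
  rewrite /dAct /word_mul (linear_lext _ _ (word_mul_linear x)).
  (* When b_i acts on x, the factor [lift_coc k y] has y a subword of N, bounded below by k, and is
     0. *)
  rewrite (eq_lext (g := fun=> 0)) ?lext0f ?add0r // => J.
  rewrite /lift_coc coc_min ?(lin0 hiota.1) ?mulr0 //.
  exact: below_subseq hy.
rewrite (linD (lext_is_linear _)) /=.
have -> : shuf (fun x y => word_mul (lift_coc i) x (k :: y)) N =
   shuf (fun x y => word_mul (fun y =>
     lext (lift_coc k) (Act (bas i) (mono y))) x y) N
   + shuf (word_mul (conn (lie (basis_lift i) (basis_lift k)))) N.
  rewrite -shufD; apply: eq_in_shuf => x y hx hy.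
  rewrite /word_mul /lift_coc (coc_cons le_total le_trans _ hAct) //; last first.
    by rewrite srt_cons // (below_subseq kN) // (srt_subseq le_trans sN).
  by rewrite -addrA (linD iotav_linear) mulrDr /conn bas_lie.
have -> : shuf (fun x y => word_mul (lift_coc i) (k :: x) y) N =
   shuf (fun x y => iota (basis_lift k) * word_mul (lift_coc i) x y) N.
  by apply: eq_shuf => x y; rewrite /word_mul lift_word_cons mulrA.
zmod.
Qed.

Lemma iota_lift_word l N : srt N -> iota l * lift_word N =
  lext lift_word (Act (pi l) (mono N)) + shuf (word_mul (conn l)) N.
Proof. by move=> hs; apply: conn_lift_word => t; apply: basis_lift_word. Qed.

End Connection.

(** * Subspaces and ordered bases *)

Lemma lspan_subset (K : fieldType) (V : lmodType K) (D : V -> Prop) v :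
  D v -> v \in lspan D.
Proof. by move=> Dv; apply/asboolP => N; apply. Qed.

Section SubspaceOf.
Context (K : fieldType) (V : lmodType K) (P : V -> Prop).
Hypotheses (P0 : P 0) (PD : forall a u v, P u -> P v -> P (a *: u + v)).

Fact subspace_of_submod : submod_closed ([pred v | `[< P v >]] : {pred V}).
Proof.
split=> [|a u v /asboolP hu /asboolP hv]; apply/asboolP => //.
exact: PD.
Qed.

Definition subspace_of : subspace V := MkSubspace subspace_of_submod.

Lemma subspace_ofP v : reflect (P v) (v \in subspace_of).
Proof. exact: asboolP. Qed.

Lemma lspan_ind (D : V -> Prop) v : (forall w, D w -> P w) -> v \in lspan D -> P v.
Proof.
by move=> DP /asboolP h; apply/subspace_ofP/h => w /DP Pw; apply/subspace_ofP.
Qed.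

End SubspaceOf.

Section OrderedBasis.
Context (K : fieldType) (V : lmodType K).

(** Transitivity is read off from the least element of {x, y, z}. *)
Lemma well_order_trans (T : eqType) (R : rel T) :
  well_order R -> [/\ total R, antisymmetric R & transitive R].
Proof.
move=> wo; have woc : wo_chain R predT by move=> C _; apply: wo.
have tot : total R by move=> a b; apply: (wo_chainW woc).
have anti : antisymmetric R by move=> a b; apply: (wo_chain_antisymmetric woc).
split=> // y x z xy yz.
have [|m [[hm lb] _]] := wo (mem [:: x; y; z]); first by exists x; apply: mem_head.
have lbx : R m x by apply: lb; rewrite !inE eqxx.
have lby : R m y by apply: lb; rewrite !inE eqxx orbT.
have lbz : R m z by apply: lb; rewrite !inE eqxx !orbT.
move: hm; rewrite !inE => /or3P[] /eqP em; rewrite em in lbx lby lbz.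
- by [].
- by rewrite (anti x y) // xy.
- by rewrite (anti z y) // lby.
Qed.

Lemma seq_max (T : eqType) (R : rel T) (s : seq T) : total R -> transitive R ->
  s != [::] -> exists2 t, t \in s & {in s, forall u, R u t}.
Proof.
move=> tot tr; have rfl t : R t t by have := tot t t; rewrite orbb.
elim: s => // a [|b s] IH _.
  by exists a; rewrite ?mem_head // => u; rewrite inE => /eqP ->.
have [//|t ht hmax] := IH; have [at'|ta] := orP (tot a t).
  exists t; first by rewrite inE ht orbT.
  by move=> u; rewrite inE => /orP[/eqP ->|/hmax].
exists a; first exact: mem_head.
by move=> u; rewrite inE => /orP[/eqP ->|/hmax/tr]; [apply: rfl|apply].
Qed.

(* The vectors that are not in the span of the smaller ones, for a well-order
   of V. *)
Lemma ordered_basis : exists (T : choiceType) (le : rel T) (bas : T -> V)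
    (co : V -> {malg K[T]}),
  [/\ total le, transitive le, antisymmetric le, linear co &
      (forall t, co (bas t) = mono t) /\ forall v, lext bas (co v) = v].
Proof.
have [R wo] := well_ordering_principle V.
have [tot anti tr] := well_order_trans wo.
pose smaller b := lspan (fun c => R c b /\ c <> b).
pose T : choiceType := {b : V | b \notin smaller b}.
pose phi : {malg K[T]} -> V := lext (fun t : T => val t).
have lphi : linear phi by apply: lext_is_linear.
have surj b : exists z, phi z = b.
  apply: contrapT => nb.
  (* Take the least vector m outside the range: either m is itself in T, or it is spanned by smaller
     vectors, which are all in the range. *)
  have [|m [[nm lb] _]] := wo (fun c => `[< ~ exists z, phi z = c >]).
    by exists b; apply/asboolP.
  move/asboolP: nm; apply; have [hm|hm] := boolP (m \in smaller m); last first.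
    by exists (mono (Sub m hm : T)); rewrite /phi lext_mono.
  apply: (lspan_ind (P := fun c => exists z, phi z = c) _ _ _ hm) =>
    [|a _ _ [u <-] [v <-]|c [cm nc]].
  - by exists 0; rewrite lin0.
  - by exists (a *: u + v); rewrite lphi.
  apply: contrapT => hc.
  apply: nc; apply: anti; rewrite cm lb //; apply/asboolP => -[z hz].
  by apply: hc; exists z.
have inj z : phi z = 0 -> z = 0.
  move=> z0; apply: contrapT => /eqP nz.
  (* The greatest letter of a nontrivial relation would lie in the span of smaller vectors. *)
  have [|t ht hmax] := @seq_max _ (relpre val R) (msupp z : seq T)
      (fun a b => tot _ _) (fun a b c => @tr _ _ _).
    apply: contraNneq nz => e; apply/eqP/malgP => k; rewrite mcoeff0.
    apply: mcoeff_outdom; have : k \notin (msupp z : seq T) by rewrite e.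
    by [].
  have /negP := valP t; apply.
  have zt : z@_t != 0 by rewrite mcoeff_neq0.
  have: phi z = z@_t *: val t + \sum_(u <- msupp z | u != t) z@_u *: val u.
    by rewrite /phi lext.unlock (bigD1_seq t) //= fset_uniq.
  rewrite z0 => /esym/eqP; rewrite addr_eq0 => /eqP e.
  rewrite -{1}[val t](scalerK zt) e; apply: rpredZ; rewrite rpredN.
  rewrite big_seq_cond; apply: rpred_sum => u /andP[hu ut]; apply: rpredZ.
  apply: lspan_subset; split; first exact: (hmax u hu).
  by move/val_inj => e'; rewrite e' eqxx in ut.
have bij b : {z | phi z = b} by apply: cid.
exists T, (relpre val R), val, (fun b => sval (bij b)).
have coK b : phi (sval (bij b)) = b by case: (bij b).
have phiI u v : phi u = phi v -> u = v.
  by move=> e; apply/eqP; rewrite -subr_eq0; apply/eqP/inj; rewrite linB // e subrr.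
split; first by move=> a b; apply: tot.
- by move=> a b c; apply: tr.
- by move=> a b /anti /val_inj.
- by move=> a u v; apply: phiI; rewrite lphi !coK.
- by split=> // t; apply: phiI; rewrite coK /phi lext_mono.
Qed.

End OrderedBasis.

(** * Linearization of identities *)

Section WordAction.
Context (K : fieldType) (V : lmodType K) (A : Type) (op : V -> A -> V).
Hypothesis op_linear : forall a, linear (op^~ a).

(** The operation is a parameter because words act both through [pact] and through [convol]. *)
Definition wact (I : Type) (a : I -> A) (w : V) (s : seq I) : V :=
  foldl (fun u i => op u (a i)) w s.
Arguments wact : simpl never.

Lemma wact_cons I (a : I -> A) w i s : wact a w (i :: s) = wact a (op w (a i)) s.
Proof. by []. Qed.

Lemma wact_linear I (a : I -> A) s : linear (fun w => wact a w s).
Proof.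
elim: s => [|i s IH] c u v //=.
by rewrite !wact_cons op_linear; apply: IH.
Qed.

Lemma wact_cat I (a : I -> A) w s t : wact a w (s ++ t) = wact a (wact a w s) t.
Proof. exact: foldl_cat. Qed.

End WordAction.
Arguments wact : simpl never.

Lemma pair_evalE (K : fieldType) (W : lie_pair K) v (w : pmod W) a :
  pair_eval v w a = lext (fun m : {fmonom nat} => wact (@pact K W) a w m) v.
Proof. by rewrite lext.unlock. Qed.

(* The words in the expansion of s under x_i := x_(2i) + x_(2i+1). *)
Fixpoint choices (s : seq nat) : seq (seq nat) :=
  if s is i :: s' then
    [seq i.*2 :: t | t <- choices s'] ++ [seq i.*2.+1 :: t | t <- choices s']
  else [:: [::]].

Section Linearization.
Context (K : fieldType) (X : lie_pair K -> Prop).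
Hypothesis mhX : multihomogeneous X.
Local Notation F := {malg K[{fmonom nat}]}.

Definition dbl (v : F) : F :=
  lext (fun m : {fmonom nat} => \sum_(s <- choices m) mono (FMonom s)) v.

Definition sift (p : pred (seq nat)) (v : F) : F :=
  lext (fun m : {fmonom nat} => if p m then mono m else 0) v.

Definition one_odd (s : seq nat) := count odd s == 1%N.

(** The first-order part of v under x_i := x_(2i) + x_(2i+1), the odd variables being the
    increments. *)
Definition linearized (v : F) : F := sift one_odd (dbl v).

Lemma lext_dbl (V : lmodType K) (f : {fmonom nat} -> V) v :
  lext f (dbl v) =
  lext (fun m : {fmonom nat} => \sum_(s <- choices m) f (FMonom s)) v.
Proof.
rewrite lext_lext; apply: eq_lext => m.
rewrite (lin_sum (lext_is_linear f)); apply: eq_bigr => s _.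
by rewrite lext_mono.
Qed.

Lemma lext_sift (V : lmodType K) (f : {fmonom nat} -> V) p v :
  lext f (sift p v) = lext (fun m : {fmonom nat} => if p m then f m else 0) v.
Proof.
rewrite lext_lext; apply: eq_lext => m.
by case: ifP => _; rewrite ?lext_mono // lin0 //; apply: lext_is_linear.
Qed.

Lemma lext_linearized (V : lmodType K) (f : seq nat -> V) v :
  lext (fun m : {fmonom nat} => f m) (linearized v) =
  lext (fun m : {fmonom nat} =>
    \sum_(s <- choices m) if one_odd s then f s else 0) v.
Proof. by rewrite lext_sift lext_dbl. Qed.

Lemma choices_wact (W : lie_pair K) (a : nat -> plie W) (w : pmod W) s :
  \sum_(t <- choices s) wact (@pact K W) a w t =
  wact (@pact K W) (fun i => a i.*2 + a i.*2.+1) w s.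
Proof.
elim: s w => [|i s IH] w /=; first by rewrite big_seq1.
rewrite big_cat !big_map /=; under eq_bigr do rewrite wact_cons.
under [X in _ + X]eq_bigr do rewrite wact_cons.
by rewrite !IH wact_cons (linD (pact_linearr w)) (linD (wact_linear (@pact_linearl
  K W) _ s)).
Qed.

Lemma dbl_identity v : identity_of X v -> identity_of X (dbl v).
Proof.
move=> hv W XW w a; rewrite pair_evalE lext_dbl.
by under eq_lext => m do rewrite choices_wact; rewrite -pair_evalE; apply: hv.
Qed.

Lemma multidegE (m : {fmonom nat}) i : multideg m i = count_mem i (m : seq nat).
Proof.
rewrite /multideg; elim: (m : seq nat) => [|j s IH] /=.
  by rewrite big_nil cm1.
by rewrite big_cons cmM IH cmU.
Qed.

Lemma multideg_perm (m n : {fmonom nat}) : multideg m = multideg n ->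
  perm_eq m n.
Proof. by move=> e; apply/allP => i _ /=; rewrite -!multidegE e. Qed.

Lemma mhcomp_eval (W : lie_pair K) alpha v (w : pmod W) a :
  pair_eval (mhcomp alpha v) w a =
  \sum_(m <- msupp v | multideg m == alpha) v@_m *: wact (@pact K W) a w m.
Proof.
rewrite pair_evalE /mhcomp (lin_sum (lext_is_linear _)); apply: eq_bigr => m _.
by rewrite lextU.
Qed.

(** A permutation-invariant [p] depends only on the multidegree, so the sifted element is a sum of
    multihomogeneous components of v. The argument works over finite fields too. *)
Lemma sift_identity p v : (forall s t, perm_eq s t -> p s = p t) ->
  identity_of X v -> identity_of X (sift p v).
Proof.
move=> pp hv W XW w a; rewrite pair_evalE lext_sift.
pose s : seq {fmonom nat} := msupp v.
pose A := undup [seq multideg m | m : {fmonom nat} <- s & p m].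
transitivity (\sum_(alpha <- A) pair_eval (mhcomp alpha v) w a); last first.
  by rewrite big1_seq // => alpha _; apply: mhX.
under [RHS]eq_bigr do rewrite mhcomp_eval.
rewrite (exchange_big_dep predT) //= lext.unlock; apply: eq_big_seq => m hm.
have -> : p m = (multideg m \in A).
  rewrite mem_undup; apply/idP/mapP => [pm|[n]].
    by exists m => //; rewrite mem_filter pm.
  by rewrite mem_filter => /andP[pn _] /multideg_perm /pp ->.
case: ifPn => hA; last first.
  rewrite scaler0 big_seq_cond big_pred0 // => alpha.
  by apply: contraNF hA => /andP[ha /eqP ->].
rewrite big_mkcond (bigD1_seq (multideg m)) ?undup_uniq //= eqxx big1 ?addr0 // =>
  alpha.
by rewrite eq_sym => /negbTE ->.
Qed.

Lemma linearized_identity v : identity_of X v -> identity_of X (linearized v).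
Proof.
move=> hv; apply: sift_identity; last exact: dbl_identity.
by move=> s t /permP e; rewrite /one_odd e.
Qed.

Section ConvolutionIdentity.
Context (T : choiceType) (VA : lie_pair K).
Hypothesis hVA : forall v, identity_of X v -> satisfies VA v.
Implicit Types (h : seq T -> pmod VA) (a : seq T -> plie VA).

Definition convol h a : seq T -> pmod VA := shuf (fun x y => pact (h x) (a y)).

Definition shift (Y : Type) (k : T) (f : seq T -> Y) N := f (k :: N).

Lemma convol_cons h a k N :
  convol h a (k :: N) = convol (shift k h) a N + convol h (shift k a) N.
Proof. by []. Qed.

Lemma convol_linearl a : linear (convol^~ a).
Proof.
move=> c h1 h2; apply/funext => N; rewrite /convol -[RHS]/(c *: _ + _) -shufZ -shufD.
by apply: eq_shuf => x y; rewrite -pact_linearl.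
Qed.

Let even_odd k (b : nat -> seq T ->
  plie VA) n := if odd n then shift k (b n./2) else b n./2.

(** Exactly one choice has no odd letter: every i becomes 2i, evaluated at b_i. *)
Lemma choices_even k b h s N :
  \sum_(t <- choices s) (if count odd t == 0%N then wact convol (even_odd k b) h t
    N else 0)
  = wact convol b h s N.
Proof.
elim: s h => [|i s IH] h /=; first by rewrite big_seq1.
rewrite big_cat !big_map /= odd_double /= [X in _ + X]big1 ?addr0 //.
by rewrite wact_cons -IH; apply: eq_bigr => t _;
  rewrite wact_cons {2}/even_odd odd_double doubleK.
Qed.

(** Leibniz rule: the shift falls on h or on a single factor b_i, and the latter cases are the
    choices with one odd letter. *)
Lemma choices_leibniz k b h s N :
  wact convol b h s (k :: N) = wact convol b (shift k h) s N +
  \sum_(t <- choices s) (if one_odd t then wact convol (even_odd k b) h t N else 0).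
Proof.
elim: s h => [|i s IH] h /=; first by rewrite big_seq1 addr0.
rewrite !wact_cons IH.
have -> : shift k (convol h (b i)) =
  convol (shift k h) (b i) + convol h (shift k (b i)).
  by apply/funext.
rewrite (linD (wact_linear convol_linearl b s)) -[LHS]addrA; congr (_ + _).
rewrite big_cat !big_map /= addrC; congr (_ + _); apply/esym.
  apply: eq_bigr => t _; rewrite /one_odd /= odd_double add0n.
  by rewrite wact_cons {2}/even_odd odd_double doubleK.
rewrite -(choices_even k); apply: eq_bigr => t _.
rewrite /one_odd /= odd_double /= add1n eqSS.
by rewrite wact_cons {2}/even_odd /= odd_double /= uphalf_double.
Qed.

(* The shift by a letter is a derivation of the convolution, so it turns v into
   v plus its linearization, on words that are shorter by one. *)
Lemma convol_identity v h b N : identity_of X v ->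
  lext (fun m : {fmonom nat} => wact convol b h m) v N = 0.
Proof.
have ev M : linear (fun f : seq T -> pmod VA => f M) by [].
elim: N v h b => [|k N IH] v h b hv; rewrite (linear_lext _ _ (ev _)).
  (* At the empty word convolution is the action of [VA] on the values there. *)
  rewrite -[RHS](hVA hv (h [::]) (fun i => b i [::])) pair_evalE.
  apply: eq_lext => m; elim: (m : seq nat) h => [|i s IHs] h //=.
  by rewrite !wact_cons IHs.
under eq_lext => m do rewrite choices_leibniz.
have IH' u g c : identity_of X u ->
    lext (fun m : {fmonom nat} => wact convol c g m N) u = 0.
  by move=> hu; rewrite -[RHS](IH u g c hu) (linear_lext _ _ (ev N)).
rewrite lextDf IH' // add0r.
rewrite -(lext_linearized (fun s => wact convol (even_odd k b) h s N)).
exact/IH'/linearized_identity.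
Qed.

End ConvolutionIdentity.
End Linearization.

(** * Lie algebras of endomorphisms, generated subobjects *)

Section SubspaceType.
Context (K : fieldType) (V : lmodType K) (N : subspace V).

Record subsp : predArgType := Subsp { subsp_val : V; _ : subsp_val \in N }.

HB.instance Definition _ := [isSub for subsp_val].
HB.instance Definition _ := [Choice of subsp by <:].
HB.instance Definition _ := [SubChoice_isSubZmodule of subsp by <:].
HB.instance Definition _ := [SubZmodule_isSubLmodule of subsp by <:].

End SubspaceType.

Section SubmodulePair.
Context (K : fieldType) (W : lie_pair K) (N : subspace (pmod W)) (aN : act_closed N).

Definition submod_pact (w : subsp N) (a : plie W) : subsp N :=
  Subsp (aN a (valP w)).

Fact submod_pact_linearl a : linear (submod_pact^~ a).
Proof. by move=> k u v; apply: val_inj; rewrite /= pact_linearl. Qed.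

Fact submod_pact_linearr w : linear (submod_pact w).
Proof. by move=> k a b; apply: val_inj; rewrite /= pact_linearr. Qed.

Fact submod_pact_lie w a b : submod_pact w (lie a b) =
  submod_pact (submod_pact w a) b - submod_pact (submod_pact w b) a.
Proof. by apply: val_inj; rewrite /= pact_lie. Qed.

Definition submod_pair : lie_pair K :=
  MkLiePair submod_pact_linearl submod_pact_linearr submod_pact_lie.

End SubmodulePair.

Section LieHull.
Context (K : fieldType) (A : lieAlgType K).

Section Hull.
Context (D : A -> Prop).

Let hullP (z : A) := forall S : lieSubalg A, (forall x, D x -> x \in S) -> z \in S.

Definition lie_hull_space : subspace A.
Proof.
apply: (@subspace_of _ _ hullP) => [S _|a u v hu hv S hS]; first exact: rpred0.
by apply: rpredD; [apply: rpredZ; exact: hu | exact: hv].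
Defined.

Fact lie_hull_lie : {in lie_hull_space &, forall x y, lie x y \in lie_hull_space}.
Proof.
move=> x y /subspace_ofP hx /subspace_ofP hy; apply/subspace_ofP => S hS.
by apply: rpred_lie; [apply: hx | apply: hy].
Qed.

Definition lie_hull : lieSubalg A := MkLieSubalg lie_hull_lie.

Lemma lie_hull_sub x : D x -> x \in lie_hull.
Proof. by move=> Dx; apply/subspace_ofP => S; apply. Qed.

Lemma lie_hull_ind (P : A -> Prop) :
  P 0 -> (forall a u v, P u -> P v -> P (a *: u + v)) ->
  (forall u v, P u -> P v -> P (lie u v)) ->
  (forall x, D x -> P x) -> forall z, z \in lie_hull -> P z.
Proof.
move=> P0 PD PL PDD z /asboolP hz.
have QL : {in subspace_of P0 PD &, forall x y, lie x y \in subspace_of P0 PD}.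
  by move=> x y /subspace_ofP hx /subspace_ofP hy; apply/subspace_ofP/PL.
apply/(subspace_ofP P0 PD)/(hz (MkLieSubalg QL)) => x Dx.
by apply/(subspace_ofP P0 PD)/PDD.
Qed.

Lemma lie_hull_generates :
  lie_generates (fun x : sublie lie_hull => D (val x)).
Proof.
move=> S hS z.
(* The membership proof is quantified so that the induction can run over elements of the ambient
   algebra. *)
suff [hz] : exists hz : val z \in lie_hull, Sublie hz \in S.
  by rewrite (_ : Sublie hz = z) //; apply: val_inj.
move: (val z) (valP z); apply: lie_hull_ind =>
  [|a u v [hu Su] [hv Sv]|u v [hu Su] [hv Sv]|x Dx].
- by exists (rpred0 _); rewrite (_ : Sublie _ = 0) ?rpred0 //; apply: val_inj.
- have h : a *: u + v \in lie_hull by rewrite rpredD ?rpredZ.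
  exists h; rewrite (_ : Sublie h = a *: Sublie hu + Sublie hv) ?rpredD ?rpredZ //.
  exact: val_inj.
- have h : lie u v \in lie_hull by apply: rpred_lie.
  exists h; rewrite (_ : Sublie h = lie (Sublie hu) (Sublie hv));
    last exact: val_inj.
  exact: rpred_lie.
- by exists (lie_hull_sub Dx); apply: hS.
Qed.

End Hull.
End LieHull.

Lemma ideal_gen_sub (K : fieldType) (A : lieAlgType K) (D : A -> Prop) x :
  D x -> x \in ideal_gen D.
Proof. by move=> Dx; apply/asboolP => J; apply. Qed.

Lemma submod_gen_sub (K : fieldType) (W : lie_pair K) (D : pmod W -> Prop) w :
  D w -> w \in submod_gen D.
Proof. by move=> Dw; apply/asboolP => N _; apply. Qed.

Lemma submod_gen_ind (K : fieldType) (W : lie_pair K) (D P : pmod W -> Prop) :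
  P 0 -> (forall a u v, P u -> P v -> P (a *: u + v)) ->
  (forall w a, P w -> P (pact w a)) -> (forall w, D w -> P w) ->
  forall z, z \in submod_gen D -> P z.
Proof.
move=> P0 PD PA PDD z /asboolP hz.
apply/(subspace_ofP P0 PD)/hz => [w a /subspace_ofP hw|w Dw].
  exact/subspace_ofP/PA.
exact/subspace_ofP/PDD.
Qed.

Section Endomorphisms.
Context (K : fieldType) (V : lmodType K).
Local Notation fct := (V -> V).

Fact linear0f : linear (0 : fct).
Proof. by move=> a u v; rewrite /= scaler0 addr0. Qed.

Fact linear_comb_f a (f g : fct) : linear f -> linear g -> linear (a *: f + g).
Proof.
move=> lf lg c u v; rewrite -[LHS]/(a *: f _ + g _) lf lg.
rewrite -[X in _ = _ *: X + _]/(a *: f u + g u) -[X in _ = _ + X]/(a *: f v + g v).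
by rewrite !scalerDr !scalerA mulrC; zmod.
Qed.

Definition endo := subsp (subspace_of linear0f linear_comb_f).

HB.instance Definition _ := GRing.Lmodule.on endo.

Definition endo_fun (f : endo) : V -> V := val f.

Lemma endo_linear f : linear (endo_fun f).
Proof. exact: (elimT (subspace_ofP linear0f linear_comb_f _) (valP f)). Qed.

Definition mk_endo (f : fct) (lf : linear f) : endo :=
  Subsp (introT (subspace_ofP linear0f linear_comb_f f) lf).

Lemma endoP (f g : endo) : endo_fun f =1 endo_fun g -> f = g.
Proof. by move=> h; apply/val_inj/funext. Qed.

Lemma endo_lieP (f g : endo) :
  linear (fun u => endo_fun g (endo_fun f u) - endo_fun f (endo_fun g u)).
Proof.
move=> a u v; rewrite !endo_linear scalerBr; zmod.
Qed.

(* The sign is the one for which endomorphisms act on the right. *)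
Definition endo_lie f g := mk_endo (endo_lieP f g).

Lemma endo_combE a f g u :
  endo_fun (a *: f + g) u = a *: endo_fun f u + endo_fun g u.
Proof. by []. Qed.

Lemma endo_lieE f g u : endo_fun (endo_lie f g) u =
  endo_fun g (endo_fun f u) - endo_fun f (endo_fun g u).
Proof. by []. Qed.

Fact endo_lie_linearl g : linear (endo_lie^~ g).
Proof.
move=> a f f'; apply: endoP => u;
  rewrite endo_combE !endo_lieE !endo_combE endo_linear.
by rewrite scalerBr; zmod.
Qed.

Fact endo_lie_linearr f : linear (endo_lie f).
Proof.
move=> a g g'; apply: endoP => u;
  rewrite endo_combE !endo_lieE !endo_combE endo_linear.
by rewrite scalerBr; zmod.
Qed.

Fact endo_liexx f : endo_lie f f = 0.
Proof. by apply: endoP => u; rewrite endo_lieE subrr. Qed.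

Fact endo_lie_jacobi f g h : endo_lie f (endo_lie g h) + endo_lie g (endo_lie h f)
  + endo_lie h (endo_lie f g) = 0.
Proof.
apply: endoP => u; rewrite -[RHS]/(0 :
  V) -[endo_lie f _ + _]scale1r endo_combE scale1r.
rewrite -[endo_lie f _]scale1r endo_combE scale1r !endo_lieE.
by rewrite !(linB (endo_linear _)); zmod.
Qed.

HB.instance Definition _ := Lmodule_isLie.Build K endo
  endo_lie_linearl endo_lie_linearr endo_liexx endo_lie_jacobi.

Fact endo_pact_linearr (w : V) : linear (fun f : endo => endo_fun f w).
Proof. by []. Qed.

Fact endo_pact_lie w (f g : endo) : endo_fun (lie f g) w =
  endo_fun g (endo_fun f w) - endo_fun f (endo_fun g w).
Proof. by []. Qed.

Definition endo_pair : lie_pair K :=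
  MkLiePair endo_linear endo_pact_linearr endo_pact_lie.

End Endomorphisms.

(** * The universal property without generation hypotheses *)

Section RelativeUniversality.
Context (K : fieldType) (X : lie_pair K -> Prop) (hX : variety X).

Lemma variety_satisfies W v : X W -> identity_of X v -> satisfies W v.
Proof. by move=> XW hv; apply: hv. Qed.

(** The defining identities are among all identities of X. *)
Lemma variety_intro W : (forall v, identity_of X v -> satisfies W v) -> X W.
Proof.
have [E hE] := hX; move=> h; apply/hE => v Ev; apply: h => W' /hE XW'.
exact: XW'.
Qed.

Lemma wact_morph (W W' : lie_pair K) (f : pmod W -> pmod W') (g : plie W -> plie W')
    (I : Type) (a : I -> plie W) w s :
  (forall w a, f (pact w a) = pact (f w) (g a)) ->
  f (wact (@pact K W) a w s) = wact (@pact K W') (fun i => g (a i)) (f w) s.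
Proof. by move=> h; elim: s w => [|i s IH] w //; rewrite !wact_cons IH h. Qed.

Lemma pair_eval_morph (W W' : lie_pair K) (f : pmod W -> pmod W') (g : plie W ->
  plie W')
    v w a : linear f -> (forall w a, f (pact w a) = pact (f w) (g a)) ->
  f (pair_eval v w a) = pair_eval v (f w) (fun i => g (a i)).
Proof.
move=> lf h; rewrite !pair_evalE (linear_lext _ _ lf); apply: eq_lext => m.
exact: wact_morph.
Qed.

Context (VA : lie_pair K) (B : lieAlgType K) (W : lie_pair K).
Context (iV : pmod VA -> pmod W) (iA : plie VA -> plie W) (iB : B -> plie W).
Hypothesis hW : mixed_wreath X VA B W iV iA iB.

(* R replaces the ideal generated by the image of A: it contains that image, is
   normalized by the images of A and B, and satisfies the identities of X. *)
Lemma wreath_extend (W1 : lie_pair K) (fV : pmod VA -> pmod W1)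
    (fA : plie VA -> plie W1) (psi : B -> plie W1) (R : subspace (plie W1)) :
  pair_hom fV fA -> lie_hom psi ->
  (forall a, fA a \in R) ->
  (forall r a, r \in R -> lie r (fA a) \in R) ->
  (forall r b, r \in R -> lie r (psi b) \in R) ->
  (forall v, identity_of X v -> forall w a, (forall i, a i \in R) ->
     pair_eval v w a = 0 :> pmod W1) ->
  exists (cV : pmod W -> pmod W1) (cA : plie W -> plie W1),
    [/\ pair_hom cV cA, forall w, cV (iV w) = fV w,
        forall a, cA (iA a) = fA a & forall b, cA (iB b) = psi b].
Proof.
move=> [lfV [lfA mfA] mfV] [lpsi mpsi] RfA RA RB RX.
pose D z := (exists a, z = fA a) \/ (exists b, z = psi b).
(* Cut W1 down to the generated subalgebra and submodule, where the generation hypotheses of the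
   universal property hold. *)
pose G := lie_hull D; pose W2 := sub_pair G.
pose N := submod_gen (W := W2) (fun w => exists w0, w = fV w0).
have aN : act_closed N by apply: submod_gen_act.
pose W3 := submod_pair aN.
have hV w : fV w \in N by apply: submod_gen_sub; exists w.
have hA a : fA a \in G by apply: lie_hull_sub; left; exists a.
have hB b : psi b \in G by apply: lie_hull_sub; right; exists b.
pose gV w : pmod W3 := Subsp (hV w).
pose gA a : plie W3 := Sublie (hA a).
pose gB b : plie W3 := Sublie (hB b).
(* By the Jacobi identity the elements normalizing R are closed under brackets. *)
have norm z : z \in G -> forall r, r \in R -> lie r z \in R.
  apply: (@lie_hull_ind _ _ D (fun z => forall r, r \in R -> lie r z \in R)) z.
  - by move=> r _; rewrite (lin0 (lie_linearr r)) rpred0.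
  - by move=> a u v hu hv r hr; rewrite lie_linearr; apply: rpredD;
    [apply/rpredZ/hu | apply/hv].
  - move=> u v hu hv r hr.
    have -> : lie r (lie u v) = lie (lie r u) v - lie (lie r v) u.
      have e1 : lie u (lie v r) = lie (lie r v) u by rewrite (lieC v) lieNr -lieC.
      have e2 : lie v (lie r u) = - lie (lie r u) v by rewrite lieC.
      have := lie_jacobi r u v; rewrite e1 e2 -addrA => /eqP.
      by rewrite addr_eq0 opprD opprK addrC => /eqP.
    by apply: rpredB; [apply/hv/hu | apply/hu/hv].
  - by move=> x [[a ->]|[b ->]] r hr; [apply: RA | apply: RB].
(* The part of R inside [W3] is an ideal containing the image of A, hence contains the ideal that
   image generates. *)
have J0 : val (0 : plie W3) \in R by apply: rpred0.
have JD a (u v : plie W3) : val u \in R -> val v \in R -> val (a *: u + v) \in R.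
  by move=> hu hv; apply: rpredD => //; apply: rpredZ.
pose J := subspace_of J0 JD.
have JL x y : x \in J -> lie x y \in J.
  by move=> /subspace_ofP hx; apply/subspace_ofP; apply: norm => //; apply: valP.
have [] := wreath_univ hW (W1 := W3) (fV := gV) (fA := gA) (psi := gB).
- split; first by move=> a u v; apply: val_inj; rewrite /= lfV.
    by split=> [a u v|u v]; apply: val_inj; rewrite /= ?lfA ?mfA.
  by move=> w a; apply: val_inj; rewrite /= mfV.
- by split=> [a u v|u v]; apply: val_inj; rewrite /= ?lpsi ?mpsi.
- move=> S hS; apply: lie_hull_generates => x; case=> [[a e]|[b e]]; apply: hS.
    by left; exists a; apply: val_inj.
  by right; exists b; apply: val_inj.
- move=> N' aN' hN' z.
  suff [hz] : exists hz : val z \in N, Subsp hz \in N'.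
    by rewrite (_ : Subsp hz = z) //; apply: val_inj.
  move: (val z) (valP z).
  refine (@submod_gen_ind _ W2 _ (fun z =>
    exists hz : z \in N, Subsp hz \in N') _ _ _ _) =>
    [|a u v [hu Nu] [hv Nv]|w a [hw Nw]|w [w0 ->]].
  + by exists (rpred0 _); rewrite (_ : Subsp _ = 0) ?rpred0 //; apply: val_inj.
  + have h : a *: u + v \in N by rewrite rpredD ?rpredZ.
    exists h; rewrite (_ : Subsp h = a *: Subsp hu + Subsp hv) ?rpredD ?rpredZ //.
    exact: val_inj.
  + exists (aN w a hw); have := aN' _ a Nw.
    by rewrite (_ : pact (Subsp hw : pmod W3) a = Subsp (aN w a hw)) //;
      apply: val_inj.
  + by exists (hV w0); apply: hN'; exists w0.
- apply: variety_intro => v hv w a; apply: val_inj => /=.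
  pose f (w : pmod W3) : pmod W1 := val w.
  pose g (a : sublie (ideal_gen (fun z : plie W3 =>
    exists a, z = gA a))) : plie W1 :=
    val (val a).
  rewrite -[LHS]/(f _) (@pair_eval_morph (sub_pair _) W1 f g) //.
  apply: RX => // i; have /asboolP := valP (a i).
  move=> /(_ (MkLieIdeal JL)) h; apply: (elimT (subspace_ofP _ _ _)) (h _).
  by move=> x [a' ->]; apply/subspace_ofP; apply: RfA.
move=> cV [cA [[lcV [lcA mcA] mcV] [eV eA eB] _]].
exists (fun w => val (cV w)), (fun a => val (cA a)); split.
- split; first by move=> a u v; rewrite lcV.
    by split=> [a u v|u v]; rewrite ?lcA ?mcA.
  by move=> w a; rewrite mcV.
- by move=> w; rewrite eV.
- by move=> a; rewrite eA.
- by move=> b; rewrite eB.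
Qed.

End RelativeUniversality.

(** * The coinduced pair *)

Section ConvolutionLie.
Context (K : fieldType) (T : choiceType) (VA : lie_pair K).
Implicit Types (h : seq T -> pmod VA) (a : seq T -> plie VA).

Definition lie_convol a b : seq T -> plie VA := shuf (fun x y => lie (a x) (b y)).

Lemma convol_linearr h : linear (convol h).
Proof.
move=> c a b; apply/funext => N; rewrite /convol -[RHS]/(c *: _ + _) -shufZ -shufD.
by apply: eq_shuf => x y; rewrite -pact_linearr.
Qed.

Lemma shift_convol k h a : shift k (convol h a) =
  convol (shift k h) a + convol h (shift k a).
Proof. exact/funext. Qed.

Lemma shift_lie_convol k a b :
  shift k (lie_convol a b) = lie_convol (shift k a) b + lie_convol a (shift k b).
Proof. exact/funext. Qed.

(** Shifts are derivations of both convolutions, which reduces the claim to shorter words; at the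
    empty word it is [pact_lie]. *)
Lemma convol_lie h a b N : convol h (lie_convol a b) N =
  convol (convol h a) b N - convol (convol h b) a N.
Proof.
elim: N h a b => [|k N IH] h a b; first by rewrite /convol /lie_convol /= pact_lie.
rewrite !convol_cons !shift_convol shift_lie_convol.
rewrite !(linD (convol_linearl _)) (linD (convol_linearr _)).
rewrite -[X in _ + X]/(convol _ _ N + convol _ _ N) !IH.
rewrite -[(convol (convol (shift k h) a) b
  + convol (convol h (shift k a)) b) N]/(_ N + _ N).
rewrite -[(convol (convol (shift k h) b) a
  + convol (convol h (shift k b)) a) N]/(_ N + _ N).
zmod.
Qed.

Lemma eq_in_convol h h' a N : (forall x, subseq x N -> h x = h' x) ->
  convol h a N = convol h' a N.
Proof. by move=> hh; apply: eq_in_shuf => x y hx _; rewrite hh. Qed.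

End ConvolutionLie.

Section Coinduced.
Context (K : fieldType) (B : lieAlgType K) (T : choiceType) (le : rel T).
Hypotheses (le_total : total le) (le_trans : transitive le)
  (le_anti : antisymmetric le).
Context (bas : T -> B) (co : B -> {malg K[T]}).
Hypothesis bas_co : forall b, lext bas (co b) = b.
Local Notation S := (word_span K T).
Context (Act : B -> S -> S) (hAct : pbw_action le bas Act).
Context (VA : lie_pair K).
Local Notation srt := (sorted le).

Definition sword := {N : seq T | srt N}.
Definition coind := sword -> pmod VA.
HB.instance Definition _ := GRing.Lmodule.on coind.
Implicit Types (h : coind) (a : seq T -> plie VA).

(** Extension by zero to all words, on which convolution and [lext] are defined. *)
Definition ext h (N : seq T) : pmod VA := if insub N is Some s then h s else 0.

Lemma ext_val h (s : sword) : ext h (val s) = h s.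
Proof. by rewrite /ext valK. Qed.

Lemma ext_sub h N (hN : srt N) : ext h N = h (Sub N hN).
Proof. by rewrite -(ext_val h (Sub N hN)). Qed.

Lemma ext_linear N : linear (ext^~ N).
Proof. by move=> c u v; rewrite /ext; case: insubP => // _;
  rewrite scaler0 addr0. Qed.

(** The support bound [Act_supp] concerns basis elements only; linearity in b extends its
    consequence to all of B. *)
Lemma eq_lext_srt (V : lmodType K) (f g : seq T -> V) b N : srt N ->
  (forall J, srt J -> f J = g J) ->
  lext f (Act b (mono N)) = lext g (Act b (mono N)).
Proof.
move=> hN fg; have la := Act_linearl hAct (mono N).
apply: (lin_basis_ext bas_co (f := fun b => lext f (Act b (mono N)))
   (g := fun b => lext g (Act b (mono N)))) => [c u v|c u v|t] /=.
- by rewrite (la c) lext_is_linear.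
- by rewrite (la c) lext_is_linear.
- by apply: eq_in_lext => J /(Act_supp hAct hN)[] sJ _; apply: fg.
Qed.

Definition mulf a h : coind := fun s => convol (ext h) a (val s).
Definition derf b h : coind := fun s => lext (ext h) (Act b (mono (val s))).

Lemma ext_mulf a h N : srt N -> ext (mulf a h) N = convol (ext h) a N.
Proof. by move=> hN; rewrite ext_sub. Qed.

Lemma ext_derf b h N : srt N -> ext (derf b h) N = lext (ext h) (Act b (mono N)).
Proof. by move=> hN; rewrite ext_sub. Qed.

Lemma extf_linear : linear (fun h => ext h : seq T -> pmod VA).
Proof. by move=> c u v; apply/funext => N; rewrite ext_linear. Qed.

Lemma mulf_linear a : linear (mulf a).
Proof.
by move=> c u v; apply/funext => s; rewrite /mulf extf_linear convol_linearl.
Qed.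

Lemma derf_linear b : linear (derf b).
Proof.
move=> c u v; apply/funext => s; rewrite /derf.
rewrite -[RHS]/(c *: lext (ext u) _ + lext (ext v) _) -lextZf -lextDf.
by apply: eq_lext => N; rewrite ext_linear.
Qed.

Definition mulE a : endo coind := mk_endo (mulf_linear a).
Definition derE b : endo coind := mk_endo (derf_linear b).

Lemma mulE_linear : linear mulE.
Proof.
move=> c a b; apply: endoP => h; rewrite endo_combE; apply/funext => s.
by rewrite -[LHS]/(convol (ext h) (c *: a + b) (val s)) convol_linearr.
Qed.

Lemma derE_linear : linear derE.
Proof.
move=> c a b; apply: endoP => h; rewrite endo_combE; apply/funext => s.
rewrite -[LHS]/(lext (ext h) (Act (c *: a + b) (mono (val s)))).
by rewrite (Act_linearl hAct) lext_is_linear.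
Qed.

Lemma mulE_lie a b : lie (mulE a) (mulE b) = mulE (lie_convol a b).
Proof.
apply: endoP => h; apply/funext => s.
rewrite -[RHS]/(convol (ext h) (lie_convol a b) (val s)) convol_lie.
rewrite -[LHS]/(convol (ext (mulf a h)) b (val s)
  - convol (ext (mulf b h)) a (val s)).
by congr (_ - _); apply: eq_in_convol => x hx; rewrite ext_mulf //;
   apply: (srt_subseq le_trans (valP s) hx).
Qed.

(** Dual to [Act_comm]: transposition turns the left action of B into a right one. *)
Lemma derE_lie b c : derE (lie b c) = lie (derE b) (derE c).
Proof.
apply: endoP => h; apply/funext => s.
rewrite -[LHS]/(lext (ext h) (Act (lie b c) (mono (val s)))).
rewrite -[RHS]/(lext (ext (derf b h)) (Act c (mono (val s)))
   - lext (ext (derf c h)) (Act b (mono (val s)))).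
rewrite -(Act_comm le_total le_trans le_anti bas_co hAct (valP s)).
rewrite (linB (lext_is_linear _)) !(lext_Act hAct _ _ (Act _ _)).
by congr (_ - _); apply: eq_lext_srt => [|J hJ]; rewrite ?ext_derf ?(valP s).
Qed.

(** By [Act_shuf], [derf b] is a derivation of the convolution, so the commutator is convolution
    with the derivative of a. *)
Lemma mulE_derE_lie a b :
  lie (mulE a) (derE b) = mulE (fun N => lext a (Act b (mono N))).
Proof.
apply: endoP => h; apply/funext => s.
rewrite -[LHS]/(lext (ext (mulf a h)) (Act b (mono (val s)))
   - convol (ext (derf b h)) a (val s)).
rewrite -[RHS]/(convol (ext h) _ (val s)).
rewrite (eq_lext_srt (g := convol (ext h) a)) ?(valP s) //; last exact: ext_mulf.
rewrite (Act_shuf le_total le_trans bas_co hAct _ _ (valP s)).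
apply/eqP; rewrite subr_eq -shufD; apply/eqP/eq_in_shuf => x y hx hy.
rewrite addrC /dAct -(linear_lext _ _ (pact_linearr _)).
rewrite -(linear_lext (ext h) _ (pact_linearl (a y))) ext_derf //.
exact: (srt_subseq le_trans (valP s) hx).
Qed.

(** The convolution operators, which serve as R in [wreath_extend]. *)
Definition mul_space : subspace (endo coind).
Proof.
apply: (@subspace_of _ _ (fun f => exists a, f = mulE a)).
  by exists 0; rewrite (lin0 mulE_linear).
by move=> c _ _ [a ->] [b ->]; exists (c *: a + b); rewrite mulE_linear.
Defined.

Lemma mul_spaceP f : reflect (exists a, f = mulE a) (f \in mul_space).
Proof. exact: subspace_ofP. Qed.

(** Subwords of sorted words are sorted, so on sorted words the operators compute iterated
    convolutions of [ext h], and [convol_identity] applies. *)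
Lemma mul_space_identity (X : lie_pair K -> Prop) v : multihomogeneous X ->
  (forall v, identity_of X v -> satisfies VA v) -> identity_of X v ->
  forall (h : pmod (endo_pair coind)) f, (forall i, f i \in mul_space) ->
  pair_eval v h f = 0.
Proof.
move=> mhX hVA hv h f hf.
have /choice[a fa] : forall i, exists a, f i = mulE a by move=> i;
  apply/mul_spaceP/hf.
apply/funext => s; have ev : linear (fun h : coind => h s) by [].
rewrite pair_evalE (linear_lext _ _ ev) -[RHS](convol_identity mhX hVA (ext h) a
  (val s) hv).
have ev' : linear (fun h : seq T -> pmod VA => h (val s)) by [].
rewrite (linear_lext _ _ ev'); apply: eq_lext => m.
have gen t (g : coind) (g' : seq T -> pmod VA) : (forall N, srt N ->
  ext g N = g' N) -> forall N, srt N ->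
    ext (wact (@pact K (endo_pair coind)) f g t) N = wact (@convol K T VA) a g' t N.
  elim: t g g' => [|i t IH] g g' gg' //; rewrite !wact_cons; apply: IH => N hN.
  rewrite fa ext_mulf //; apply: eq_in_convol => x hx; apply: gg'.
  exact: (srt_subseq le_trans hN hx).
by rewrite -[LHS]ext_val; apply: gen => //; apply: valP.
Qed.

End Coinduced.

(** * Free Lie algebras acting through the free associative algebra *)

(** The map from L into S fixing the generators, followed by the inclusion, is the identity by
    uniqueness. *)
Lemma free_lie_generates (K : fieldType) (I : Type) (L : lieAlgType K) (x : I -> L) :
  free_lie x -> lie_generates (fun z => exists i, z = x i).
Proof.
move=> fx S hS z; have hx i : x i \in S by apply: hS; exists i.
have [f [[lf mf] fxi _]] := fx (sublie S) (fun i => Sublie (hx i)).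
have [g [_ _ gu]] := fx L x.
have e : (fun z => val (f z)) =1 g.
  apply: gu => [|i]; last by rewrite fxi.
  by split=> [a u v|u v]; rewrite ?lf ?mf.
have -> : z = val (f z) by rewrite e -(gu id).
exact: valP.
Qed.

Section FreeAction.
Context (K : fieldType) (I : choiceType).
Local Notation F := (freealg K I).

Lemma mono_fword (m : {fmonom I}) : mono m = \prod_(i <- (m :
  seq I)) freegen K i :> F.
Proof.
rewrite -{1}(fmK m); elim: (m : seq I) => [|i s IH].
  by rewrite big_nil mono.unlock -fmoneE.
rewrite big_cons -IH mono.unlock /freegen malgM_def fgmulUU mulr1; congr << _ >>.
by apply/eqP; rewrite fmP fmM fmU.
Qed.

Lemma lin_mono_ext (X : choiceType) (V : lmodType K) (f g : {malg K[X]} -> V) :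
  linear f -> linear g -> (forall k, f (mono k) = g (mono k)) -> f =1 g.
Proof.
move=> lf lg h z; rewrite -(lext_basis z) !(linear_lext _ _ lf, linear_lext _ _ lg).
exact: eq_lext.
Qed.

Context (W : lie_pair K) (g : I -> plie W).

Definition free_act (w : pmod W) (u : F) : pmod W :=
  lext (fun m : {fmonom I} => wact (@pact K W) g w m) u.

Lemma free_act_linearr w : linear (free_act w).
Proof. exact: lext_is_linear. Qed.

Lemma free_act_linearl u : linear (free_act^~ u).
Proof.
move=> a v w; rewrite /free_act -lextZf -lextDf; apply: eq_lext => m.
exact: (wact_linear (@pact_linearl K W)).
Qed.

Lemma free_act_mono w (m : {fmonom I}) :
  free_act w (mono m) = wact (@pact K W) g w m.
Proof. exact: lext_mono. Qed.

Lemma free_act_gen w i : free_act w (freegen K i) = pact w (g i).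
Proof.
have -> : freegen K i = mono (fmu i) by rewrite mono.unlock.
by rewrite free_act_mono fmU.
Qed.

Lemma free_act1 w : free_act w 1 = w.
Proof.
have -> : 1 = mono (mone : {fmonom I}) :> F by rewrite mono.unlock.
by rewrite free_act_mono fm1.
Qed.

Lemma free_actM w u v : free_act w (u * v) = free_act (free_act w u) v.
Proof.
move: u v; have lm (u : F) : linear (fun v => free_act w (u * v)).
  by move=> a v v'; rewrite mulrDr -scalerAr free_act_linearr.
have lm' (v : F) : linear (fun u => free_act w (u * v)).
  by move=> a u u'; rewrite mulrDl -scalerAl free_act_linearr.
move=> u v; apply: (lin_mono_ext (lm' v) (g := fun u =>
  free_act (free_act w u) v)) => [a u1 u2|m].
  by rewrite free_act_linearr free_act_linearl.
apply: (lin_mono_ext (lm (mono m)) (@free_act_linearr (free_act w (mono m)))) => n.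
rewrite !free_act_mono -(wact_cat _ g w m n).
suff -> : mono m * mono n = mono (mmul m n) :> F by rewrite free_act_mono fmM.
by rewrite !mono_fword fmM big_cat.
Qed.

(** The elements l for which the two actions agree form a subalgebra containing the generators. *)
Lemma free_act_lie (L : lieAlgType K) (x : I -> L) (iota : L -> F) (G : L ->
  plie W) :
  free_lie x -> lie_assoc_hom iota -> (forall i, iota (x i) = freegen K i) ->
  lie_hom G -> (forall i, G (x i) = g i) ->
  forall l w, free_act w (iota l) = pact w (G l).
Proof.
move=> fx [li mi] ix [lG mG] Gx.
pose P l := forall w, free_act w (iota l) = pact w (G l).
have P0 : P 0.
  by move=> w; rewrite (lin0 li) (lin0 lG) (lin0 (free_act_linearr w)) (lin0
    (pact_linearr w)).
have PD a u v : P u -> P v -> P (a *: u + v).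
  by move=> hu hv w; rewrite li lG free_act_linearr pact_linearr hu hv.
have PL : {in subspace_of P0 PD &, forall u v, lie u v \in subspace_of P0 PD}.
  move=> u v /subspace_ofP hu /subspace_ofP hv; apply/subspace_ofP => w.
  rewrite mG pact_lie -(hv (pact w (G u))) -(hu w) -(hu (pact w (G v))) -(hv w).
  by rewrite -!free_actM mi; apply: linB; apply: free_act_linearr.
move=> l; apply/(subspace_ofP P0 PD).
apply: (free_lie_generates fx (S := MkLieSubalg PL)) => _ [i ->].
by apply/(subspace_ofP P0 PD) => w; rewrite ix Gx free_act_gen.
Qed.

End FreeAction.

(** * Separation by the coinduced pair *)

Section Separation.
Context (K : fieldType) (X : lie_pair K -> Prop).
Context (I : choiceType) (L : lieAlgType K) (x : I -> L) (M : lieIdeal L).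
Context (iota : L -> freealg K I) (hiota : lie_assoc_hom iota).
Hypothesis iota_x : forall i, iota (x i) = freegen K i.
Context (F1 : algType K) (j : sublie M -> F1) (hj : lie_assoc_hom j).
Context (e : {lrmorphism F1 -> freealg K I}).
Hypothesis e_j : forall m : sublie M, e (j m) = iota (val m).
Context (T : choiceType) (le : rel T).
Hypotheses (le_total : total le) (le_trans : transitive le).
Context (bas : T -> quotlie M) (co : quotlie M -> {malg K[T]}).
Hypotheses (bas_co : forall b, lext bas (co b) = b).
Local Notation S := (word_span K T).
Context (Act : quotlie M -> S -> S) (hAct : pbw_action le bas Act).
Local Notation srt := (sorted le).
Local Notation F := (freealg K I).
Local Notation VA := (verbal_quot X (reg_pair hj)).
Local Notation pi := (qpi M : L -> quotlie M).
Local Notation word := (Datatypes_prod__canonical__choice_Choice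
  (Datatypes_list__canonical__choice_Choice T)
  (Datatypes_list__canonical__choice_Choice (sublie M))).
Local Notation C := {malg K[word]}.

Definition gen_op i : endo (coind le VA) :=
  mulE le (VA := VA) (conn le bas_co Act (x i)) + derE le Act VA (pi (x i)).

Lemma ext_gen_op h i N : srt N -> ext (endo_fun (gen_op i) h) N =
  lext (ext h) (Act (pi (x i)) (mono N))
    + convol (VA := VA) (ext h) (conn le bas_co Act (x i)) N.
Proof.
move=> hN; rewrite -(ext_derf Act) // -(ext_mulf (VA := VA)) // addrC.
by rewrite !(ext_sub _ hN).
Qed.

Definition ideal_word (ms : seq (sublie M)) : F := \prod_(m <- ms) iota (val m).
Definition coset_word (p : word) : F := lift_word bas iota p.1 * ideal_word p.2.
(** The pairing of h with a formal term (N, ms): the value h(N) acted on by the letters of ms in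
    turn. *)
Definition probe (h : coind le VA) (p : word) : pmod VA :=
  wact (@pact K VA) id (ext h p.1) p.2.

(* Formal sums of pairs (N, ms) stand for elements [sum s(N) ms] of F, where ms
   is a product of elements of M; [coset_step i] is multiplication by x_i. *)
Definition coset_step i (p : word) : C :=
  lext (fun J : seq T => mono ((J, p.2) : word)) (Act (pi (x i)) (mono p.1)) +
  shuf (fun a b => mono ((a, conn le bas_co Act (x i) b :: p.2) : word)) p.1.

Fixpoint coset_form (s : seq I) : C :=
  if s is i :: s' then lext (coset_step i) (coset_form s')
  else mono (([::], [::]) : word).

Lemma coset_step_word i p : srt p.1 ->
  lext coset_word (coset_step i p) = freegen K i * coset_word p.
Proof.
case: p => N ms /= hN; rewrite /coset_word /= mulrA -iota_x.
rewrite (iota_lift_word le_total le_trans bas_co hiota hAct) // mulrDl.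
rewrite (linD (lext_is_linear _)) (linear_lext _ _ (lext_is_linear _)).
rewrite (linear_lext _ _ (mull_linear _)); congr (_ + _).
  by apply: eq_lext => J; rewrite lext_mono.
rewrite (linear_shuf _ _ (lext_is_linear _)) (linear_shuf _ _ (mull_linear _)).
apply: eq_shuf => a b; rewrite lext_mono /word_mul /ideal_word big_cons /=.
by rewrite mulrA.
Qed.

(** [gen_op i] is the transpose of [coset_step i]: the PBW terms pair with the coderivation, the
    terms from the connection with the convolution. *)
Lemma coset_step_probe h i p : srt p.1 ->
  lext (probe h) (coset_step i p) = probe (endo_fun (gen_op i) h) p.
Proof.
case: p => N ms /= hN; rewrite /probe /= ext_gen_op //.
have lw := wact_linear (@pact_linearl K VA) id ms.
rewrite (linD lw) (linD (lext_is_linear _)) (linear_lext _ _ lw).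
rewrite (linear_lext _ _ (lext_is_linear _)); congr (_ + _).
  by apply: eq_lext => J; rewrite lext_mono.
rewrite (linear_shuf _ _ (lext_is_linear _)) (linear_shuf _ _ lw).
by apply: eq_shuf => a b; rewrite lext_mono.
Qed.

Definition srt_supp (z : C) := {in msupp z, forall p, srt p.1}.

Lemma srt_suppD (u v : C) : srt_supp u -> srt_supp v -> srt_supp (u + v).
Proof.
move=> hu hv p /(fsubsetP (msuppD_le _ _)); rewrite inE => /orP[];
  [exact: hu|exact: hv].
Qed.

Lemma coset_form_srt s : srt_supp (coset_form s).
Proof.
elim: s => [|i s IH]; first by move=> p /msupp_mono ->.
apply: msupp_lext => -[N ms] /IH /= hN; apply: srt_suppD.
  (* The support bound is known for basis elements, so b is expanded in the basis. *)
  move: (pi (x i)) => b; rewrite -(bas_co b).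
  rewrite (linear_lext _ _ (Act_linearl hAct (mono N))) lext_lext.
  apply: msupp_lext => t _; apply: msupp_lext => J hJ p /msupp_mono -> /=.
  by have [] := Act_supp hAct hN hJ.
have: forall a, subseq a N -> srt a by move=> a ha;
  apply: (srt_subseq le_trans hN ha).
rewrite -[N]/(N, ms).1; set f := fun a b : seq T => _ => /= hsub.
have hf a b : subseq a N -> srt_supp (f a b).
  by move=> ha p /msupp_mono -> /=; apply: hsub.
elim: N f hf {hN hsub} => [|k N IHN] f hf /=; first exact: hf.
by apply: srt_suppD; apply: IHN => a b ha; apply: hf => /=;
  rewrite ?eqxx //; apply: (subseq_trans ha (subseq_cons _ _)).
Qed.

Lemma coset_form_word s :
  lext coset_word (coset_form s) = \prod_(i <- s) freegen K i.
Proof.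
elim: s => [|i s IH] /=.
  by rewrite lext_mono /coset_word /lift_word /ideal_word !big_nil mulr1.
rewrite big_cons -IH lext_lext (linear_lext _ _ (mulr_linear _)).
by apply: eq_in_lext => p /coset_form_srt; apply: coset_step_word.
Qed.

Lemma coset_form_probe h s : lext (probe h) (coset_form s) =
  ext (wact (@pact K (endo_pair (coind le VA))) gen_op h s) [::].
Proof.
elim: s h => [|i s IH] h; first by rewrite /= lext_mono.
rewrite wact_cons -IH /= lext_lext.
by apply: eq_in_lext => p /coset_form_srt; apply: coset_step_probe.
Qed.

Lemma ideal_word_e ms : ideal_word ms = e (\prod_(m <- ms) j m).
Proof. by rewrite rmorph_prod; apply: eq_bigr => m _; rewrite -e_j. Qed.

Lemma wact_qpi u ms :
  wact (@pact K VA) id (qpi (verbal X (reg_pair hj)) u) ms =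
  qpi (verbal X (reg_pair hj)) (u * \prod_(m <- ms) j m).
Proof.
elim: ms u => [|m ms IH] u; first by rewrite big_nil mulr1.
rewrite wact_cons big_cons mulrA -IH; congr wact.
exact: (qpi_pact (@verbal_act K X (reg_pair hj)) u m).
Qed.

(** Collect u as a sum of s(J) [q J] over sorted words J and test it against functions h
    concentrated at one word. *)
Lemma separation (u : F) :
  (forall h : coind le VA, free_act (W := endo_pair (coind le VA)) gen_op h u = 0) ->
  u \in mul_verbal X hj e.
Proof.
move=> hu; pose c : C := lext (fun m : {fmonom I} => coset_form m) u.
have uc : u = lext coset_word c.
  rewrite lext_lext -{1}(lext_basis u); apply: eq_lext => m.
  by rewrite coset_form_word mono_fword.
have hc h : lext (probe h) c = 0.
  have ev : linear (fun h : coind le VA => ext h [::]) by apply: ext_linear.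
  rewrite lext_lext -(lin0 ev) -[in RHS](hu h) (linear_lext _ _ ev).
  by apply: eq_lext => m; rewrite coset_form_probe.
have cs : srt_supp c by apply: msupp_lext => m _; apply: coset_form_srt.
pose q (J : seq T) : F1 :=
  lext (fun p : word => if p.1 == J then \prod_(m <- p.2) j m else 0) c.
have hq J : srt J -> q J \in verbal X (reg_pair hj).
  move=> hJ; rewrite -[q J]subr0; apply/(@qpiP K _ (verbal X (reg_pair hj))).
  have lq : linear (qpi (verbal X (reg_pair hj))) by apply: qpi_linear.
  (* This h takes the class of 1 at J and 0 elsewhere, so its pairing with c is the class of
     [q J]. *)
  rewrite (lin0 lq) -(hc (fun s => if val s == J then qpi _ 1 else 0)).
  rewrite (linear_lext _ _ lq); apply: eq_in_lext => -[N ms] /cs /= hN.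
  rewrite /probe (ext_sub _ hN) /=; case: ifP => _.
    by rewrite wact_qpi mul1r.
  by rewrite (lin0 lq) (lin0 (wact_linear (@pact_linearl K VA) _ _)).
pose s : seq word := msupp c.
pose A := undup [seq p.1 | p : word <- s].
have -> : u = \sum_(J <- A) lift_word bas iota J * e (q J).
  rewrite uc.
  transitivity (\sum_(J <- A) lext (fun p : word =>
      if p.1 == J then coset_word p else 0) c); last first.
    apply: eq_bigr => J _; rewrite /q.
    have le' : linear (fun v => lift_word bas iota J * e v).
      by move=> a v w; rewrite linearP mulrDr scalerAr.
    rewrite (linear_lext _ _ le'); apply: eq_lext => p.
    case: eqP => [<-|_]; first by rewrite /coset_word ideal_word_e.
    exact: (esym (lin0 le')).
  rewrite lext.unlock exchange_big; apply: eq_big_seq => p hp /=.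
  have hA : p.1 \in A by rewrite mem_undup; apply/mapP; exists p.
  rewrite (bigD1_seq p.1) ?undup_uniq //= eqxx big1 ?addr0 // => J.
  by rewrite eq_sym => /negbTE ->; rewrite scaler0.
rewrite big_seq_cond; apply: rpred_sum => J; rewrite andbT mem_undup.
case/mapP => p hp ->; apply: lspan_subset; exists (lift_word bas iota p.1), (q p.1).
by split=> //; apply/hq/cs.
Qed.

End Separation.

(** * The embedding *)

Lemma verbal_quot_satisfies (K : fieldType) (X : lie_pair K ->
  Prop) (W : lie_pair K) v :
  identity_of X v -> satisfies (verbal_quot X W) v.
Proof.
move=> hv q a; rewrite -(qreprK q).
have lq : linear (qpi (verbal X W)) by apply: qpi_linear.
rewrite -(@pair_eval_morph _ W (verbal_quot X W) _ id _ _ _ lq); last first.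
  by move=> w b; apply/esym/(qpi_pact (@verbal_act K X W)).
rewrite -(lin0 lq); apply/qpiP; rewrite subr0; apply: submod_gen_sub.
by exists v, (qrepr q), a.
Qed.

Section ZeroPair.
Context (K : fieldType) (A : lieAlgType K).

Fact zero_pact_lin : linear (fun _ : 'rV[K]_0 => 0 : 'rV[K]_0).
Proof. by move=> a u v; rewrite scaler0 addr0. Qed.

Fact zero_pact_linr : linear (fun _ : A => 0 : 'rV[K]_0).
Proof. by move=> a u v; rewrite scaler0 addr0. Qed.

(** With the zero module every identity holds, so the universal property yields maps of the Lie
    components alone. *)
Definition zero_pair : lie_pair K :=
  @MkLiePair K 'rV[K]_0 A (fun _ _ => 0) (fun=> zero_pact_lin)
    (fun=> zero_pact_linr) (fun _ _ _ => esym (subrr 0)).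

End ZeroPair.

Lemma lie_hom_comp (K : fieldType) (A B C : lieAlgType K) (f : A -> B) (g : B -> C) :
  lie_hom f -> lie_hom g -> lie_hom (fun a => g (f a)).
Proof.
by move=> [lf mf] [lg mg]; split=> [a u v|u v]; rewrite ?lf ?mf ?lg ?mg.
Qed.

Lemma free_lie_ext (K : fieldType) (I : Type) (L A : lieAlgType K) (x : I -> L)
    (f g : L -> A) :
  free_lie x -> lie_hom f -> lie_hom g -> (forall i, f (x i) = g (x i)) -> f =1 g.
Proof.
move=> fx hf hg fg l; have [h [_ _ hu]] := fx A (fun i => g (x i)).
by rewrite (hu f) // (hu g).
Qed.

Lemma pi_eqP (K : fieldType) (L : lieAlgType K) (M : lieIdeal L) u v :
  (qpi M u : quotlie M) = qpi M v <-> u - v \in M.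
Proof. exact: qpiP. Qed.

Section Embedding.
Context (K : fieldType) (X : lie_pair K -> Prop)
  (hX : variety X) (mhX : multihomogeneous X) (I : choiceType).
Context (L : lieAlgType K) (x : I -> L) (free_x : free_lie x) (M : lieIdeal L).
Context (iota : L -> freealg K I) (hiota : lie_assoc_hom iota)
  (iota_x : forall i, iota (x i) = freegen K i).
Context (F1 : algType K) (j : sublie M -> F1) (hj : lie_assoc_hom j).
Context (e : {lrmorphism F1 -> freealg K I})
  (e_j : forall m : sublie M, e (j m) = iota (val m)).
Context (L1 : lieAlgType K) (y : I -> L1) (free_y : free_lie y).
Context (iota1 : L1 -> freealg K I) (hiota1 : lie_assoc_hom iota1)
  (iota1_y : forall i, iota1 (y i) = freegen K i).
Context (W : lie_pair K)
  (iV : pmod (verbal_quot X (reg_pair hiota1)) -> pmod W)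
  (iA : L1 -> plie W) (iB : quotlie M -> plie W)
  (hW : mixed_wreath X (verbal_quot X (reg_pair hiota1)) (quotlie M) W iV iA iB).
Local Notation pi := (qpi M : L -> quotlie M).
Local Notation V1 := (verbal X (reg_pair hiota1)).

Definition wreath_gen i : plie W := iA (y i) + iB (pi (x i)).

Context (g : L -> plie W) (hg : lie_hom g) (gx : forall i, g (x i) = wreath_gen i).
Let iB_hom : lie_hom iB. Proof. by have [] := wreath_lie_mono hW. Qed.

(* Sending [L/M] and the module to 0 maps x_i to y_i, which is invertible. *)
Lemma lie_component_inj : injective g.
Proof.
have [] := wreath_univ hW (W1 := zero_pair L1) (fV := fun=> 0) (fA := id)
  (psi := fun=> 0).
- by split=> // a u v; rewrite scaler0 addr0.
- by split=> [a u v|u v]; rewrite ?scaler0 ?addr0 ?liexx.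
- by move=> S hS z; apply: hS; left; exists z.
- by move=> N _ _ z; rewrite (thinmx0 z) rpred0.
- by apply: (variety_intro hX) => v _ w a; apply: thinmx0.
move=> _ [cA [[_ hcA _] [_ cAA cAB] _]].
have [p [hp py _]] := free_y x.
have id_hom : lie_hom (fun l : L => l) by [].
apply: (can_inj (g := fun z => p (cA z))).
apply: (free_lie_ext free_x _ id_hom) => [|i].
  exact/lie_hom_comp/hp/lie_hom_comp/hcA.
by rewrite gx /wreath_gen (linD hcA.1) cAA cAB addr0 py.
Qed.

Let P := ideal_gen (fun z => exists a, z = iA a).

(** Modulo P the maps [g] and [iB] after [pi] agree on the generators of L, hence on L, and the
    second kills M. *)
Lemma lie_component_ideal l : l \in M -> g l \in P.
Proof.
move=> hl; have pi_hom : lie_hom pi.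
  by split; [apply: qpi_linear | move=> u v; apply: pi_lie].
have piP_hom : lie_hom (qpi P : plie W -> quotlie P).
  by split; [apply: qpi_linear | move=> u v; apply: pi_lie].
have h1 := lie_hom_comp hg piP_hom.
have h2 := lie_hom_comp (lie_hom_comp pi_hom iB_hom) piP_hom.
have := free_lie_ext free_x h1 h2 _ l => /=.
have -> : pi l = 0 by rewrite -(lin0 pi_hom.1); apply: (pi_eqP M l 0).2;
  rewrite subr0.
rewrite (lin0 iB_hom.1) => h; rewrite -[g l]subr0; apply: (pi_eqP P _ _).1.
apply: h => i; apply: (pi_eqP P _ _).2; rewrite gx /wreath_gen addrK.
by apply: ideal_gen_sub; exists (y i).
Qed.

Let w0 := iV (qpi V1 1).

Lemma free_act_component l w : free_act wreath_gen w (iota l) = pact w (g l).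
Proof. exact: (free_act_lie free_x). Qed.

Lemma ideal_identity v w (a : nat -> plie W) : identity_of X v ->
  (forall i, a i \in P) -> pair_eval v w a = 0.
Proof.
move=> hv ha; pose a' i : sublie P := @Sublie _ _ (ideal_subalg P) (a i) (ha i).
have := variety_satisfies (wreath_ideal hW) hv w a' => h.
have /= := @pair_eval_morph _ (sub_pair P) W id val v w a'.
by rewrite h => <-.
Qed.

(** For fixed f, the map [phi f] is compatible with the actions of M and of P, so it sends values of
    identities on F1 to values of identities for P, which are 0. *)
Lemma mul_verbal_free_act u : u \in mul_verbal X hj e ->
  free_act wreath_gen w0 u = 0.
Proof.
move=> hu; have l0 := free_act_linearr wreath_gen w0.
apply: (lspan_ind (P := fun u => free_act wreath_gen w0 u = 0) _ _ _ hu) =>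
  [|a v v' hv hv'|].
- exact: lin0.
- by rewrite l0 hv hv' scaler0 addr0.
move=> _ [f [q [hq ->]]].
pose phi (f : freealg K I) (u : F1) := free_act wreath_gen w0 (f * e u).
have lphi f' : linear (phi f').
  by move=> a v v'; rewrite /phi linearP mulrDr -scalerAr l0.
have aphi f' (v : pmod (reg_pair hj)) m :
  phi f' (pact v m) = pact (phi f' v) (g (val m)).
  by rewrite -free_act_component -free_actM -mulrA -e_j -rmorphM.
move: q hq f; apply: (@submod_gen_ind _ (reg_pair hj) _ (fun q =>
  forall f, phi f q = 0)).
- by move=> f; apply: lin0.
- by move=> a u1 u2 h1 h2 f; rewrite lphi h1 h2 scaler0 addr0.
- by move=> v m hv f; rewrite aphi hv; apply: (lin0 (pact_linearl _)).
- move=> _ [v [v' [a [hv ->]]]] f.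
  rewrite (@pair_eval_morph _ (reg_pair hj) W (phi f) (fun m => g (val m))) //.
  by apply: ideal_identity => // i; apply/lie_component_ideal/valP.
Qed.

(** Any h is the image of [w0] under a homomorphism carrying [wreath_gen i] to [gen_op i]; hence u
    kills every h and [separation] applies. *)
Lemma free_act_eq0 u : free_act wreath_gen w0 u = 0 -> u \in mul_verbal X hj e.
Proof.
move=> hu.
have [T [le [bas [co [le_total le_trans le_anti co_lin [co_bas bas_co]]]]]] :=
  ordered_basis (quotlie M).
have [Act hAct] := pbw_action_exists le_total le_trans co_lin co_bas.
pose VA := verbal_quot X (reg_pair hj).
have hVA v : identity_of X v -> satisfies VA v by apply: verbal_quot_satisfies.
pose W1 := endo_pair (coind le VA).
pose m i : plie W1 := mulE le (VA := VA) (conn le bas_co Act (x i)).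
apply: (separation hiota iota_x e_j le_total le_trans hAct (bas_co := bas_co)) => h.
have [fA [hfA fAy _]] := free_y m.
have fAl l z : free_act m z (iota1 l) =
  pact z (fA l) by apply: (free_act_lie free_y).
pose R := mul_space le VA.
have R_lie : {in R &, forall r s, lie r s \in R}.
  move=> _ _ /mul_spaceP[a ->] /mul_spaceP[b ->]; apply/mul_spaceP.
  by exists (lie_convol a b); apply: mulE_lie.
have fAR l : fA l \in R.
  have P0 : fA 0 \in R by rewrite (lin0 hfA.1) rpred0.
  have PD a u1 u2 : fA u1 \in R -> fA u2 \in R -> fA (a *: u1 + u2) \in R.
    by move=> h1 h2; rewrite hfA.1 rpredD ?rpredZ.
  have PL : {in subspace_of P0 PD &, forall u1 u2, lie u1 u2 \in subspace_of P0 PD}.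
    move=> u1 u2 /subspace_ofP h1 /subspace_ofP h2; apply/subspace_ofP.
    by rewrite hfA.2 R_lie.
  apply/(subspace_ofP P0 PD)/(free_lie_generates free_y (S := MkLieSubalg PL)).
  move=> _ [i ->]; apply/(subspace_ofP P0 PD); rewrite fAy.
  by apply/mul_spaceP; exists (conn le bas_co Act (x i)).
have R_identity v : identity_of X v -> forall (z : pmod W1) (a : nat -> plie W1),
    (forall i, a i \in R) -> pair_eval v z a = 0.
  by move=> hv z a ha; apply: (mul_space_identity le_trans mhX hVA hv).
(* The map z to h z carries values of identities on the regular pair to values on convolution
   operators, so it factors through the quotient by V1. *)
have kill z : z \in V1 -> free_act (W := W1) m h z = 0.
  have lm := free_act_linearr (W := W1) m h.
  move: z; apply: (@submod_gen_ind _ (reg_pair hiota1) _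
    (fun z => free_act (W := W1) m h z = 0)) =>
      [|a u1 u2 h1 h2|u1 a h1|_ [v [v' [a [hv ->]]]]].
  - exact: lin0.
  - by rewrite lm h1 h2 scaler0 addr0.
  - by rewrite -[pact u1 a]/(u1 * iota1 a) free_actM fAl h1;
    apply: (lin0 (pact_linearl _)).
  - rewrite (@pair_eval_morph K (reg_pair hiota1) W1 (free_act (W := W1) m h) fA)
    //; first exact: R_identity.
    by move=> w a'; rewrite -fAl -free_actM.
pose fV (q : pmod (verbal_quot X (reg_pair hiota1))) : pmod W1 :=
  free_act (W := W1) m h (qrepr q).
have fVE z : fV (qpi V1 z) = free_act (W := W1) m h z.
  apply/eqP; rewrite -subr_eq0 -(linB (free_act_linearr _ _)); apply/eqP/kill.
  exact: qreprP.
have fV_hom : pair_hom fV fA.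
  split=> // [a p q|q a].
    rewrite -(qreprK p) -(qreprK q) -qpi_linear !fVE; exact: free_act_linearr.
  rewrite -(qreprK q).
  have -> : pact (l := verbal_quot X (reg_pair hiota1)) (qpi V1 (qrepr q)) a =
      qpi V1 (qrepr q * iota1 a).
    exact: (qpi_pact (@verbal_act K X (reg_pair hiota1))).
  by rewrite !fVE free_actM fAl.
have psi_hom : lie_hom (derE le Act VA : quotlie M -> plie W1).
  split; first exact: (derE_linear hAct).
  by move=> b c; apply: (derE_lie le_total le_trans le_anti bas_co hAct).
have RA (r : plie W1) a : r \in R -> lie r (fA a) \in R.
  by move=> hr; apply: (R_lie _ _ hr (fAR a)).
have RB (r : plie W1) b : r \in R -> lie r (derE le Act VA b) \in R.
  move=> /mul_spaceP[a ->]; apply/mul_spaceP; eexists.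
  exact: (mulE_derE_lie le_total le_trans bas_co hAct).
have [cV [cA [[lcV [lcA _] acV] eV eA eB]]] :=
  @wreath_extend _ _ hX _ _ _ _ _ _ hW W1 _ _ _ R fV_hom psi_hom fAR RA RB
    R_identity.
have cVw0 : cV w0 = h by rewrite eV fVE free_act1.
rewrite -[RHS](lin0 lcV) -[in RHS]hu /free_act (linear_lext _ _ lcV).
apply: eq_lext => s; rewrite (wact_morph _ _ _ acV) cVw0.
congr (wact _ _ _ _); apply/funext => i.
by rewrite (linD lcA) eA eB fAy.
Qed.

End Embedding.

Theorem theorem1 (K : fieldType) (X : lie_pair K -> Prop)
  (hX : variety X) (mhX : multihomogeneous X)
  (I : choiceType)
  (L : lieAlgType K) (x : I -> L) (free_x : free_lie x)
  (M : lieIdeal L)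
  (iota : L -> freealg K I) (hiota : lie_assoc_hom iota)
  (iota_x : forall i, iota (x i) = freegen K i)
  (F1 : algType K) (j : sublie M -> F1) (hj : enveloping j)
  (e : {lrmorphism F1 -> freealg K I}) (inj_e : injective e)
  (e_j : forall m : sublie M, e (j m) = iota (val m))
  (L1 : lieAlgType K) (y : I -> L1) (free_y : free_lie y)
  (iota1 : L1 -> freealg K I) (hiota1 : lie_assoc_hom iota1)
  (iota1_y : forall i, iota1 (y i) = freegen K i)
  (W : lie_pair K)
  (iV : pmod (verbal_quot X (reg_pair hiota1)) -> pmod W)
  (iA : L1 -> plie W) (iB : quotlie M -> plie W)
  (hW : mixed_wreath X (verbal_quot X (reg_pair hiota1)) (quotlie M) W
          iV iA iB) :
  exists (hN : act_closed (W := reg_pair hiota) (mul_verbal X hj.1 e))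
         (f : quotsp (mul_verbal X hj.1 e) -> pmod W) (g : L -> plie W),
    [/\ pair_mono (W := quot_pair hN) f g,
        forall i, g (x i) = iA (y i) + iB (qpi M (x i)) &
        f (qpi (mul_verbal X hj.1 e) 1) =
          iV (qpi (verbal X (reg_pair hiota1)) 1)].
Proof.
pose N := mul_verbal X hj.1 e.
have [g [hg gx _]] := free_x (plie W) (wreath_gen x y iA iB).
pose ft := free_act (wreath_gen x y iA iB) (iV (qpi (verbal X (reg_pair hiota1)) 1)).
have basis_lift : linear ft by apply: free_act_linearr.
have ft_g l u : ft (u * iota l) = pact (ft u) (g l).
  by rewrite /ft free_actM (free_act_component free_x hiota iota_x hg gx).
(* Being exactly this kernel makes N a submodule, lets [ft] descend to the quotient, and makes the
   descended map injective. *)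
have ker u : ft u = 0 <-> u \in N.
  split; last exact: (mul_verbal_free_act free_x hiota iota_x e_j hW hg gx).
  exact: (free_act_eq0 hX mhX hiota iota_x hj.1 e_j free_y iota1_y hW).
have hN : act_closed (W := reg_pair hiota) N.
  move=> u l /ker hu; apply/ker; rewrite -[pact u l]/(u * iota l) ft_g hu.
  exact: (lin0 (pact_linearl _)).
pose f (q : quotsp N) := ft (qrepr q).
have fE u : f (qpi N u) = ft u.
  by apply/eqP; rewrite -subr_eq0 -(linB basis_lift); apply/eqP/ker/qreprP.
exists hN, f, g; split=> //; last by rewrite fE /ft free_act1.
split; last exact: (lie_component_inj hX free_x free_y hW hg gx).
  split=> // [a p q|q l].
    by rewrite -(qreprK p) -(qreprK q) -qpi_linear !fE basis_lift.
  by rewrite -(qreprK q) [pact _ _](qpi_pact hN) !fE ft_g.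
move=> p q; rewrite -(qreprK p) -(qreprK q) !fE => pq; apply/qpiP/ker.
by rewrite (linB basis_lift) pq subrr.
Qed.
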